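(* Let $n\ge 1$, let $\Gamma\subset\mathrm{PSL}(2,\mathbb{C})$ be a discrete group that satisfies the (CG)-property, and let $G=\varrho(\Gamma)\subset\mathrm{PSL}(n+1,\mathbb{C})$ be the associated Veronese group, where $\varrho$ is the irreducible representation. Then $G$ acts properly discontinuously on $\mathbb{CP}^n\setminus L^{Ext}_{CG}(G)$, the complement of the extended Conze-Guivarc'h limit set of $G$. Moreover, $L^{Ext}_{CG}(G)$ is a minimal $G$-invariant closed subset of $\mathbb{CP}^n$ on whose complement the action of $G$ is properly discontinuous; that is, it is minimal with respect to inclusion among the closed $G$-invariant sets $W\subset\mathbb{CP}^n$ such that $G$ acts properly discontinuously on $\mathbb{CP}^n\setminus W$.
   Context: (CG)-property: an element of $\mathrm{PSL}(k,\mathbb{C})$ is proximal if some lift to $\mathrm{SL}(k,\mathbb{C})$ is proximal, i.e. has an eigenvalue of maximal norm (a simple eigenvalue of modulus strictly larger than that of all others). A discrete subgroup $\Gamma\subset\mathrm{PSL}(2,\mathbb{C})$ satisfies the (CG)-property if it contains proximal elements and its action on $\mathbb{CP}^1$ is strongly irreducible, i.e. no proper nonzero subspace is invariant under a finite-index subgroup of $\Gamma$. $\Lambda(\Gamma)\subset\mathbb{CP}^1$ denotes the limit set of $\Gamma$. Veronese embedding: $\psi:\mathbb{CP}^1\to\mathbb{CP}^n$, $\psi([x:y])=\left[x^n:\binom{n}{1}x^{n-1}y:\cdots:\binom{n}{n-1}xy^{n-1}:y^n\right]$. The irreducible representation $\varrho:\mathrm{PSL}(2,\mathbb{C})\to\mathrm{PSL}(n+1,\mathbb{C})$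 is the homomorphism induced by the action of $\mathrm{SL}(2,\mathbb{C})$ on homogeneous polynomials of degree $n$ in two variables, normalized so that $\varrho(A)\psi(z)=\psi(Az)$ for all $A\in\mathrm{PSL}(2,\mathbb{C})$, $z\in\mathbb{CP}^1$. A Veronese group is the image $\varrho(\Gamma)$ of a discrete subgroup $\Gamma$. Quasi-projective maps: a nonzero linear map $T:\mathbb{C}^{k}\to\mathbb{C}^{k}$, up to scalars, induces a map $\mathbb{CP}^{k-1}\setminus[\ker T]\to\mathbb{CP}^{k-1}$, $[z]\mapsto[Tz]$; the space of these is $(M(k,\mathbb{C})\setminus\{0\})/\mathbb{C}^*$, and its kernel and image are the projectivizations of those of $T$. Let $(\gamma_m)$ be a sequence of distinct elements of $\Gamma$ such that $\varrho(\gamma_m)$ converges to a quasi-projective map $g$ which is not in $\mathrm{PSL}(n+1,\mathbb{C})$; then the image of $g$ is a point. The sequence $(\varrho(\gamma_m))$ is of loxodromic type if $\mathrm{im}(g)\notin\ker(g)$. Write singular value decompositions $\gamma_m=u_ma_mv_m$ with $u_m,v_m$ unitary and $a_m$ diagonal with entries $\sigma_1(\gamma_m)>\sigma_2(\gamma_m)>0$, and after passing to a subsequence let $u=\lim u_m$. For $1\le j\le n$ put $$F_j^+=[\varrho(u)(\langle e_1,\dots,e_j\rangle)]\subset\mathbb{CP}^n,$$ where $e_1,\dots,e_{n+1}$ is the standard basis of $\mathbb{C}^{n+1}$. Extended Conze-Guivarc'h limit set: for $p\in\Lambda(\Gamma)$ let $\xi^+_{\lfloor (n+2)/2\rfloor}(\psi(p))$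 denote the projective subspace $F^+_{\lfloor (n+2)/2\rfloor}$ associated to a divergent sequence of loxodromic type in $\varrho(\Gamma)$ whose quasi-projective limit has image $\psi(p)$ (it depends only on $p$). Then $$L^{Ext}_{CG}(\varrho(\Gamma))=\overline{\bigcup_{p\in\Lambda(\Gamma)}\xi^+_{\lfloor (n+2)/2\rfloor}(\psi(p))}.$$ *)

(* Defs.v *)
From HB Require Import structures.
From mathcomp Require Import all_boot all_order all_algebra.
From mathcomp Require Import complex.
From mathcomp Require Import all_classical all_reals all_analysis.
From mathcomp Require Import zify ring.

Set Implicit Arguments.
Unset Strict Implicit.
Unset Printing Implicit Defensive.
Import Order.TTheory GRing.Theory Num.Theory.
Local Open Scope classical_set_scope.
Local Open Scope ring_scope.
Local Open Scope quotient_scope.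
Local Open Scope sesquilinear_scope.

Section VeroneseMatrix.
Variables (C : numFieldType) (n : nat).

Definition veronese_vec (v : 'cV[C]_2) : 'cV[C]_n.+1 :=
  \col_(i < n.+1) ('C(n, i)%:R * v 0 0 ^+ (n - i) * v 1 0 ^+ i).

(* The vector (x, y) is read as the linear form x X + y Y and A acts on forms
   accordingly: X |-> a X + c Y, Y |-> b X + d Y for A = [a b; c d].  Column j
   lists the coefficients of (a X + c Y)^(n-j) (b X + d Y)^j, the image of
   X^(n-j) Y^j; homogeneous polynomials are dehomogenized at X = 1, and 'X
   stands for Y.  In this basis veronese_vec (x, y) is (x X + y Y)^n. *)
Definition veronese_mx (A : 'M[C]_2) : 'M[C]_n.+1 :=
  \matrix_(i < n.+1, j < n.+1)
    (((A 0 0)%:P + A 1 0 *: 'X) ^+ (n - j) *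
     ((A 0 1)%:P + A 1 1 *: 'X) ^+ j)`_i.

Lemma veronese_vecE (v : 'cV[C]_2) i :
  veronese_vec v i 0 = (((v 0 0)%:P + v 1 0 *: 'X) ^+ n)`_i.
Proof.
rewrite mxE exprDn coef_sum (bigD1 i) //= big1 => [|j /negPf ji].
  rewrite addr0 coefMn exprZn -polyC_exp mul_polyC scalerA coefZ coefXn eqxx.
  by rewrite mulr1 -[RHS]mulr_natl mulrA.
rewrite coefMn exprZn -polyC_exp mul_polyC scalerA coefZ coefXn.
by rewrite (inj_eq val_inj) eq_sym ji mulr0 mul0rn.
Qed.

Lemma veronese_mx_vec (A : 'M[C]_2) (v : 'cV[C]_2) :
  veronese_mx A *m veronese_vec v = veronese_vec (A *m v).
Proof.
apply/colP=> i; rewrite veronese_vecE [LHS]mxE.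
have -> : ((A *m v) 0 0)%:P + (A *m v) 1 0 *: 'X =
   v 0 0 *: ((A 0 0)%:P + A 1 0 *: 'X) + v 1 0 *: ((A 0 1)%:P + A 1 1 *: 'X).
  rewrite !mxE !big_ord_recl !big_ord0 !addr0 -!mul_polyC !polyCD !polyCM.
  rewrite (_ : lift ord0 ord0 = 1) //; last exact: val_inj.
  by ring.
rewrite exprDn coef_sum; apply: eq_bigr => j _; rewrite !mxE.
rewrite !exprZn coefMn -scalerAl -scalerAr scalerA coefZ -mulr_natl; ring.
Qed.

Lemma veronese_vecZ (c : C) (v : 'cV[C]_2) :
  veronese_vec (c *: v) = c ^+ n *: veronese_vec v.
Proof.
apply/colP=> i; rewrite !mxE !exprMn.
have -> : c ^+ n = c ^+ (n - i) * c ^+ i by rewrite -exprD subnK // -ltnS.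
ring.
Qed.

Lemma veronese_vec_neq0 (v : 'cV[C]_2) : v != 0 -> veronese_vec v != 0.
Proof.
apply: contraNneq => /colP V0.
have [x0 y0] : v 0 0 = 0 /\ v 1 0 = 0.
  have := V0 0; have := V0 ord_max; rewrite !mxE /= subn0 subnn expr0 binn bin0.
  rewrite expr0 !mulr1 !mul1r => /eqP y0 /eqP x0.
  by move: x0 y0; rewrite !expf_eq0 => /andP[_ /eqP ->] /andP[_ /eqP ->].
apply/eqP/colP=> i; rewrite mxE.
by have /orP[/eqP->|/eqP->] : (i == 0) || (i == 1) by case: i => [[|[|]]].
Qed.

Lemma veronese_vec_span (M : 'M[C]_n.+1) :
  (forall v, M *m veronese_vec v = 0) -> M = 0.
Proof.
move=> M0; apply/matrixP=> i j; rewrite mxE.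
pose p := \poly_(l < n.+1) (M i (inord l) * 'C(n, l)%:R).
have p0 : p = 0.
  apply: (@roots_geq_poly_eq0 _ p [seq l%:R | l <- iota 0 n.+1]).
  - apply/allP=> _ /mapP[l _ ->]; apply/rootP.
    have := M0 (\col_k (if k == 0 then 1 else l%:R)).
    move=> /colP/(_ i); rewrite !mxE horner_poly => e.
    rewrite -[RHS]e; apply: eq_bigr => k _; rewrite !mxE /= expr1n mulr1 inord_val.
    by rewrite mulrA.
  - rewrite map_inj_uniq ?iota_uniq // => a b /eqP; rewrite eqr_nat => /eqP //.
  - by rewrite size_map size_iota size_poly.
have /eqP : p`_j = 0 by rewrite p0 coef0.
rewrite coef_poly ltn_ord inord_val mulf_eq0 pnatr_eq0 -leqn0 leqNgt bin_gt0.
by rewrite -ltnS ltn_ord orbF => /eqP.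
Qed.

Lemma veronese_mxM (A B : 'M[C]_2) :
  veronese_mx (A *m B) = veronese_mx A *m veronese_mx B.
Proof.
apply/eqP; rewrite -subr_eq0; apply/eqP; apply: veronese_vec_span => v.
by rewrite mulmxBl -mulmxA !veronese_mx_vec mulmxA subrr.
Qed.

Lemma veronese_mxZ (c : C) (A : 'M[C]_2) :
  veronese_mx (c *: A) = c ^+ n *: veronese_mx A.
Proof.
apply/matrixP=> i j; rewrite !mxE.
have h (a b : C) : (c * a)%:P + (c * b) *: 'X = c *: (a%:P + b *: 'X).
  by rewrite -!mul_polyC !polyCM; ring.
rewrite !h !exprZn -scalerAl -scalerAr scalerA -exprD subnK //.
  by rewrite coefZ.
by rewrite -ltnS ltn_ord.
Qed.

Lemma det_mx22 (A : 'M[C]_2) : \det A = A 0 0 * A 1 1 - A 0 1 * A 1 0.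
Proof.
rewrite (expand_det_row _ ord0) !big_ord_recl big_ord0 addr0 /cofactor.
rewrite !det_mx11 !mxE /= !expr0 expr1 mul1r mulN1r mulrN.
by congr (_ * A _ _ - A _ _ * A _ _); apply: val_inj.
Qed.

Lemma sum_ord_subn : (\sum_(j < n.+1) (n - j) = \sum_(j < n.+1) j)%N.
Proof.
rewrite (reindex_inj rev_ord_inj) /=; apply: eq_bigr => j _.
by rewrite subSS subKn // -ltnS ltn_ord.
Qed.

Lemma veronese_diag (a d : C) :
  a * d = 1 -> \prod_(j < n.+1) (a ^+ (n - j) * d ^+ j) = 1.
Proof.
move=> ad; rewrite big_split /= !prodrXr sum_ord_subn.
by rewrite -exprMn ad expr1n.
Qed.

Lemma coef_lin_gt (b d : C) j i : (j < i)%N -> ((b%:P + d *: 'X) ^+ j)`_i = 0.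
Proof.
move=> ji; apply/leq_sizeP: (leqnn i); apply: leq_trans ji.
elim: j {i} => [|j ih]; first by rewrite expr0 size_poly1.
rewrite exprS (leq_trans (size_polyMleq _ _)) //.
have : (size (b%:P + d *: 'X)%R <= 2)%N.
  rewrite (leq_trans (size_polyD _ _)) // geq_max (leq_trans (size_polyC_leq1 _)) //.
  by rewrite (leq_trans (size_scale_leq _ _)) // size_polyX.
lia.
Qed.

Lemma coef_lin_top (b d : C) j : ((b%:P + d *: 'X) ^+ j)`_j = d ^+ j.
Proof.
elim: j => [|j ih]; first by rewrite !expr0 coef1.
rewrite !exprS mulrDl coefD coefCM coef_lin_gt // mulr0 add0r.
by rewrite -scalerAl coefZ coefXM /= ih.
Qed.

Lemma det_veronese_upper (A : 'M[C]_2) :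
  A 1 0 = 0 -> \det A = 1 -> \det (veronese_mx A) = 1.
Proof.
move=> c0 dA; have ad : A 0 0 * A 1 1 = 1 by rewrite -dA det_mx22 c0 mulr0 subr0.
rewrite -det_tr det_trig.
  rewrite -[RHS](veronese_diag ad); apply: eq_bigr => j _; rewrite !mxE.
  rewrite c0 scale0r addr0 -polyC_exp mul_polyC coefZ; congr (_ * _).
  exact: coef_lin_top.
apply/is_trig_mxP => i j ij; rewrite !mxE c0 scale0r addr0 -polyC_exp mul_polyC.
by rewrite coefZ coef_lin_gt ?mulr0.
Qed.

Lemma det_veronese_lower (A : 'M[C]_2) :
  A 0 1 = 0 -> \det A = 1 -> \det (veronese_mx A) = 1.
Proof.
move=> b0 dA; have ad : A 0 0 * A 1 1 = 1 by rewrite -dA det_mx22 b0 mul0r subr0.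
have E i j : veronese_mx A i j =
    A 1 1 ^+ j * (if (i < j)%N then 0
                  else (((A 0 0)%:P + A 1 0 *: 'X) ^+ (n - j))`_(i - j)).
  by rewrite mxE b0 add0r exprZn -scalerAr coefZ coefMXn.
rewrite det_trig; last by apply/is_trig_mxP => i j ij; rewrite E ij mulr0.
rewrite -[RHS](veronese_diag ad); apply: eq_bigr => j _; rewrite E ltnn subnn mulrC.
by rewrite -horner_coef0 !hornerE.
Qed.

Lemma det_veronese_mx (A : 'M[C]_2) : \det A = 1 -> \det (veronese_mx A) = 1.
Proof.
suff h (B : 'M[C]_2) : B 0 0 != 0 -> \det B = 1 -> \det (veronese_mx B) = 1.
  move=> dA; have [a0|] := eqVneq (A 0 0) 0; last by move/h; apply.
  pose U : 'M[C]_2 := \matrix_(i, j) (if (i <= j)%N then 1 else 0).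
  have dU : \det U = 1 by rewrite det_mx22 !mxE /= mulr0 mulr1 subr0.
  have U00 : (U *m A) 0 0 != 0.
    rewrite !mxE !big_ord_recl big_ord0 !mxE /= a0 mulr0 add0r mul1r addr0.
    apply/eqP => c0; move: dA; rewrite det_mx22 a0 mul0r sub0r.
    rewrite (_ : A 1 0 = 0) ?mulr0 ?oppr0 => [/eqP|].
      by rewrite eq_sym oner_eq0.
    by rewrite -[RHS]c0; congr (A _ _); apply: val_inj.
  have := h _ U00; rewrite veronese_mxM !det_mulmx dU dA mul1r => /(_ erefl).
  by rewrite (@det_veronese_upper U) ?mul1r // mxE.
move=> a0 dB.
pose L : 'M[C]_2 := \matrix_(i, j)
  (if i == j then 1 else if (i < j)%N then 0 else B 1 0 / B 0 0).
pose U : 'M[C]_2 := \matrix_(i, j)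
  (if (j < i)%N then 0 else if i == 0 then B 0 j else (B 0 0)^-1).
have dL : \det L = 1 by rewrite det_mx22 !mxE /= mul0r mulr1 subr0.
have dU : \det U = 1 by rewrite det_mx22 !mxE /= mulr0 subr0 mulfV.
have -> : B = L *m U.
  have l1 : lift ord0 ord0 = 1 :> 'I_2 by exact: val_inj.
  have d : B 1 1 = B 1 0 / B 0 0 * B 0 1 + (B 0 0)^-1.
    by move: dB; rewrite det_mx22 => dB; apply: (mulfI a0); rewrite mulrDr mulfV // -dB; field.
  apply/matrixP=> i j; rewrite mxE !big_ord_recl big_ord0 addr0 l1 !mxE.
  have /orP[/eqP->|/eqP->] : (i == 0) || (i == 1) by case: i => [[|[|]]].
    have /orP[/eqP->|/eqP->] : (j == 0) || (j == 1) by case: j => [[|[|]]].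
      by rewrite /= mul1r mul0r addr0.
    by rewrite /= mul1r mul0r addr0.
  have /orP[/eqP->|/eqP->] : (j == 0) || (j == 1) by case: j => [[|[|]]].
    by rewrite /= mulr0 addr0 divfK.
  by rewrite /= mul1r.
by rewrite veronese_mxM det_mulmx det_veronese_lower ?det_veronese_upper ?mul1r // mxE.
Qed.

End VeroneseMatrix.

Import numFieldNormedType.Exports.

(* The complex numbers are R[i] with R : realType.  The library gives the norm
   topology to abstract number fields only; these instances transfer it to
   R[i], and thereby to 'M[R[i]]_(m, n). *)
HB.instance Definition _ (R : realType) := PseudoPointedMetric.copy R[i] R[i]^o.
HB.instance Definition _ (R : realType) := NormedModule.copy R[i] R[i]^o.

Section Collinear.
Variables (C : fieldType) (T : Type) (m n : nat) (f : T -> 'M[C]_(m, n)).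

Definition collinear (x y : T) : bool :=
  `[< exists2 c : C, c != 0 & f y = c *: f x >].

Lemma collinearP (x y : T) :
  reflect (exists2 c : C, c != 0 & f y = c *: f x) (collinear x y).
Proof. exact: asboolP. Qed.

Lemma collinear_refl : reflexive collinear.
Proof. by move=> x; apply/collinearP; exists 1; rewrite ?oner_eq0 ?scale1r. Qed.

Lemma collinear_sym : symmetric collinear.
Proof.
suff h x y : collinear x y -> collinear y x by move=> x y; apply/idP/idP; apply: h.
move=> /collinearP[c c0 e]; apply/collinearP; exists c^-1; first by rewrite invr_eq0.
by rewrite e scalerA mulVf // scale1r.
Qed.

Lemma collinear_trans : transitive collinear.
Proof.
move=> y x z /collinearP[c c0 e] /collinearP[d d0 e'].
by apply/collinearP; exists (d * c); rewrite ?mulf_neq0 // e' e scalerA.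
Qed.

End Collinear.

Section ProjectiveSpace.
Variables (R : realType) (m n : nat).

Definition nonzero_mx : set 'M[R[i]]_(m.+1, n.+1) := [set A | A != 0].

Canonical nonzero_mx_equiv :=
  EquivRel (collinear (@set_val _ nonzero_mx)) (collinear_refl _)
    (collinear_sym _) (collinear_trans (f:=_)).

(* The projectivization of M_{m+1,n+1}(C), with the quotient topology. *)
Definition PM : Type := quotient_topology {eq_quot nonzero_mx_equiv}.
HB.instance Definition _ := Topological.on PM.
HB.instance Definition _ := Quotient.on PM.

Fact const_mx1_neq0 : const_mx 1 \in nonzero_mx.
Proof.
rewrite inE; apply/eqP => /matrixP/(_ 0 0); rewrite !mxE.
by apply/eqP; rewrite oner_eq0.
Qed.

(* The class [A]; the value at A = 0 is junk. *)
Definition pclass (A : 'M[R[i]]_(m.+1, n.+1)) : PM :=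
  \pi_PM (insubd (SigSub const_mx1_neq0 : nonzero_mx) A).

Definition prepr (x : PM) : 'M[R[i]]_(m.+1, n.+1) := set_val (repr x).

Lemma nonzero_mx_insubd A : A != 0 ->
  set_val (insubd (SigSub const_mx1_neq0 : nonzero_mx) A) = A.
Proof. by move=> A0; apply: insubdK; rewrite inE. Qed.

Lemma pi_PM_eqP (a b : nonzero_mx) :
  (exists2 c, c != 0 & set_val b = c *: set_val a) <-> \pi_PM a = \pi_PM b.
Proof.
have h := @eqmodE _ nonzero_mx_equiv a b.
split=> [/collinearP e|e]; first by move: h; rewrite /= e => /eqP.
by apply/collinearP; move: h; rewrite /= => <-; apply/eqP.
Qed.

Lemma prepr_neq0 (x : PM) : prepr x != 0.
Proof. exact: (set_valP (repr x)). Qed.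

Lemma pclass_eq (A B : 'M[R[i]]_(m.+1, n.+1)) (c : R[i]) :
  c != 0 -> B = c *: A -> pclass A = pclass B.
Proof.
move=> c0 e; have [A0|A0] := eqVneq A 0; first by rewrite e A0 scaler0.
have B0 : B != 0 by rewrite e scaler_eq0 negb_or c0.
by apply/pi_PM_eqP; exists c; rewrite // !nonzero_mx_insubd.
Qed.

Lemma pclassK (A : 'M[R[i]]_(m.+1, n.+1)) : A != 0 ->
  exists2 c, c != 0 & prepr (pclass A) = c *: A.
Proof.
move=> A0; have [c c0 e] : exists2 c : R[i], c != 0 & prepr (pclass A) =
    c *: set_val (insubd (SigSub const_mx1_neq0 : nonzero_mx) A).
  by apply/pi_PM_eqP; rewrite reprK.
by exists c; rewrite // e nonzero_mx_insubd.
Qed.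

End ProjectiveSpace.

Notation CP R n := (PM R n 0).

(* (M(n+1,C) \ {0}) / C^*, the space of quasi-projective maps of CP^n *)
Notation QP R n := (PM R n n).

Section QuasiProjective.
Variables (R : realType) (n : nat).

Definition qp_ker (g : QP R n) : set (CP R n) :=
  [set z | prepr g *m prepr z = 0].

Definition qp_app (g : QP R n) (z : CP R n) : CP R n :=
  pclass (prepr g *m prepr z).

Definition qp_im (g : QP R n) : set (CP R n) := qp_app g @` ~` qp_ker g.

End QuasiProjective.

Section SpecialLinear.
Variables (R : realType) (k : nat).

Definition unimodular : set 'M[R[i]]_k := [set A | \det A = 1].

Definition SL : Type := set_type unimodular.
HB.instance Definition _ := SubChoice.on SL.
HB.instance Definition _ := Topological.on SL.

Definition slval (A : SL) : 'M[R[i]]_k := set_val A.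

Lemma slval_inj : injective slval.
Proof. exact: val_inj. Qed.

Lemma slP (A : SL) : \det (slval A) = 1.
Proof. exact: (set_valP A). Qed.

Lemma sl_unit (A : SL) : slval A \in unitmx.
Proof. by rewrite unitmxE slP unitr1. Qed.

Definition mkSL (A : 'M[R[i]]_k) (dA : \det A = 1) : SL := SigSub (mem_set dA).

Lemma mkSLK A (dA : \det A = 1) : slval (mkSL dA) = A.
Proof. by []. Qed.

Definition sl_one : SL := mkSL (det1 _ k).

Fact sl_mul_subproof (A B : SL) : \det (slval A *m slval B) = 1.
Proof. by rewrite det_mulmx !slP mulr1. Qed.
Definition sl_mul (A B : SL) : SL := mkSL (sl_mul_subproof A B).

Fact sl_inv_subproof (A : SL) : \det (invmx (slval A)) = 1.
Proof. by rewrite det_inv slP invr1. Qed.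
Definition sl_inv (A : SL) : SL := mkSL (sl_inv_subproof A).

Fact sl_mulA : associative sl_mul.
Proof. by move=> A B D; apply: slval_inj; rewrite !mkSLK mulmxA. Qed.
Fact sl_mul1g : left_id sl_one sl_mul.
Proof. by move=> A; apply: slval_inj; rewrite !mkSLK mul1mx. Qed.
Fact sl_mulg1 : right_id sl_one sl_mul.
Proof. by move=> A; apply: slval_inj; rewrite !mkSLK mulmx1. Qed.
Fact sl_mulVg : left_inverse sl_one sl_inv sl_mul.
Proof. by move=> A; apply: slval_inj; rewrite !mkSLK mulVmx // sl_unit. Qed.
Fact sl_mulgV : right_inverse sl_one sl_inv sl_mul.
Proof. by move=> A; apply: slval_inj; rewrite !mkSLK mulmxV // sl_unit. Qed.

HB.instance Definition _ :=
  isGroup.Build SL sl_mulA sl_mul1g sl_mulg1 sl_mulVg sl_mulgV.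

(* For matrices of determinant 1, being proportional is being equal modulo the
   centre { zeta I : zeta^k = 1 } of SL(k,C). *)
Canonical sl_equiv :=
  EquivRel (collinear slval) (collinear_refl _)
    (collinear_sym _) (collinear_trans (f:=_)).

Definition PSL : Type := quotient_topology {eq_quot sl_equiv}.
HB.instance Definition _ := Topological.on PSL.
HB.instance Definition _ := Choice.on PSL.
HB.instance Definition _ := Quotient.on PSL.

Lemma psl_eqP (A B : SL) :
  (exists2 c, c != 0 & slval B = c *: slval A) <-> \pi_PSL A = \pi_PSL B.
Proof.
have h := @eqmodE _ sl_equiv A B.
split=> [/collinearP e|e]; first by move: h; rewrite /= e => /eqP.
by apply/collinearP; move: h; rewrite /= => <-; apply/eqP.
Qed.

Definition psl_one : PSL := \pi_PSL 1%g.
Definition psl_mul (g h : PSL) : PSL := \pi_PSL (repr g * repr h)%g.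
Definition psl_inv (g : PSL) : PSL := \pi_PSL (repr g)^-1%g.

Lemma psl_repr (A : SL) :
  exists2 c, c != 0 & slval (repr (\pi_PSL A)) = c *: slval A.
Proof. by apply/psl_eqP; rewrite reprK. Qed.

Lemma psl_piM (A B : SL) : psl_mul (\pi_PSL A) (\pi_PSL B) = \pi_PSL (A * B)%g.
Proof.
rewrite /psl_mul; apply/esym/psl_eqP.
have [c c0 e] := psl_repr A; have [d d0 e'] := psl_repr B.
exists (c * d); first by rewrite mulf_neq0.
by rewrite /= !mkSLK e e' -scalemxAl -scalemxAr scalerA.
Qed.

Lemma psl_piV (A : SL) : psl_inv (\pi_PSL A) = \pi_PSL A^-1%g.
Proof.
rewrite /psl_inv; apply/esym/psl_eqP.
have [c c0 e] := psl_repr A.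
exists c^-1; first by rewrite invr_eq0.
by rewrite /= !mkSLK e invmxZ // unitmxZ ?unitfE // sl_unit.
Qed.

Fact psl_mulA : associative psl_mul.
Proof.
move=> g h l; rewrite -[g]reprK -[h]reprK -[l]reprK.
by rewrite (psl_piM (repr h)) !(psl_piM (repr g)) psl_piM mulgA.
Qed.
Fact psl_mul1g : left_id psl_one psl_mul.
Proof. by move=> g; rewrite -[g]reprK psl_piM mul1g. Qed.
Fact psl_mulg1 : right_id psl_one psl_mul.
Proof. by move=> g; rewrite -[g]reprK psl_piM mulg1. Qed.
Fact psl_mulVg : left_inverse psl_one psl_inv psl_mul.
Proof. by move=> g; rewrite -[g]reprK psl_piV psl_piM mulVg. Qed.
Fact psl_mulgV : right_inverse psl_one psl_inv psl_mul.
Proof. by move=> g; rewrite -[g]reprK psl_piV psl_piM mulgV. Qed.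

HB.instance Definition _ :=
  isGroup.Build PSL psl_mulA psl_mul1g psl_mulg1 psl_mulVg psl_mulgV.

Lemma psl_mulE (A B : SL) : (\pi_PSL A * \pi_PSL B)%g = \pi_PSL (A * B)%g.
Proof. exact: psl_piM. Qed.

End SpecialLinear.

Section Subgroups.
Variable G : groupType.
Local Open Scope group_scope.

Definition subgroup (H : set G) : Prop :=
  H 1 /\ forall x y, H x -> H y -> H (x * y^-1).

Definition finite_index_subgroup (H K : set G) : Prop :=
  [/\ subgroup H, H `<=` K &
      finite_set [set [set x * h | h in H] | x in K]].

End Subgroups.

Section ProjectiveAction.
Variables (R : realType) (n : nat).
Implicit Types (G : set (PSL R n.+1)) (W K : set (CP R n)).

Definition psl_act (g : PSL R n.+1) (z : CP R n) : CP R n :=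
  pclass (slval (repr g) *m prepr z).

Definition psl_qp (g : PSL R n.+1) : QP R n := pclass (slval (repr g)).

Definition invariant_set G W : Prop :=
  forall g z, G g -> W z -> W (psl_act g z).

Definition acts_properly_discontinuously G (W : set (CP R n)) : Prop :=
  invariant_set G W /\
  forall K, compact K -> K `<=` W ->
    finite_set [set g | G g /\ psl_act g @` K `&` K !=set0].

Definition pd_complement G W : Prop :=
  [/\ closed W, invariant_set G W & acts_properly_discontinuously G (~` W)].

Definition minimal_pd_complement G W : Prop :=
  pd_complement G W /\ forall W', pd_complement G W' -> W' `<=` W -> W' = W.

End ProjectiveAction.

Section CGProperty.
Variables (R : realType) (k : nat).

Definition proximal_mx (A : 'M[R[i]]_k) : Prop :=
  exists l : R[i],
    [/\ eigenvalue A l, mup l (char_poly A) = 1%N &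
        forall l', eigenvalue A l' -> l' != l -> `|l'| < `|l|].

Definition proximal (g : PSL R k) : Prop :=
  exists A : SL R k, \pi_(PSL R k) A = g /\ proximal_mx (slval A).

Definition invariant_subspace (H : set (PSL R k)) (U : {vspace 'cV[R[i]]_k}) :=
  forall h, H h -> forall v, v \in U -> slval (repr h) *m v \in U.

Definition strongly_irreducible (G : set (PSL R k)) : Prop :=
  forall (H : set (PSL R k)) (U : {vspace 'cV[R[i]]_k}),
    finite_index_subgroup H G -> invariant_subspace H U ->
    U = 0%VS \/ U = fullv.

Definition discrete_subgroup (G : set (PSL R k)) : Prop :=
  subgroup G /\ G `<=` isolated G.

End CGProperty.

Definition CG_property (R : realType) (G : set (PSL R 2)) : Prop :=
  (exists2 g, G g & proximal g) /\ strongly_irreducible G.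

Section LimitSet.
Variable R : realType.

Definition posdef_mx (P : 'M[R[i]]_2) : Prop :=
  P ^t* = P /\ forall v : 'cV[R[i]]_2, v != 0 -> 0 < (v ^t* *m P *m v) 0 0.

(* Hyperbolic space H^3 is the set of classes [P] of positive definite
   Hermitian 2x2 matrices, on which A in SL(2,C) acts by P |-> A P A^*; it is
   compactified inside P(M_2(C)) by the sphere CP^1, [v] being the rank one
   class [v v^*].  The limit set consists of the points of this sphere at which
   orbits of points of H^3 accumulate. *)
Definition hyp_orbit (G : set (PSL R 2)) (P : 'M[R[i]]_2) : set (QP R 1) :=
  [set pclass (slval (repr g) *m P *m (slval (repr g)) ^t*) | g in G].

Definition boundary_point (p : CP R 1) : QP R 1 :=
  pclass (prepr p *m (prepr p) ^t*).

Definition limit_set (G : set (PSL R 2)) : set (CP R 1) :=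
  [set p | exists2 P, posdef_mx P & closure (hyp_orbit G P) (boundary_point p)].

End LimitSet.


Section VeroneseGroup.
Variables (R : realType) (n : nat).

Definition psi (z : CP R 1) : CP R n := pclass (veronese_vec n (prepr z)).

Definition rho_sl (A : SL R 2) : SL R n.+1 := mkSL (det_veronese_mx n (slP A)).

Definition rho (g : PSL R 2) : PSL R n.+1 := \pi_(PSL R n.+1) (rho_sl (repr g)).

Lemma rho_pi (A : SL R 2) :
  rho (\pi_(PSL R 2) A) = \pi_(PSL R n.+1) (rho_sl A).
Proof.
apply/esym/psl_eqP; have [c c0 e] := psl_repr A.
exists (c ^+ n); first by rewrite expf_neq0.
by rewrite !mkSLK e veronese_mxZ.
Qed.

Lemma rhoM (g h : PSL R 2) : rho (g * h)%g = (rho g * rho h)%g.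
Proof.
rewrite -[g]reprK -[h]reprK psl_mulE !rho_pi psl_mulE; congr (\pi_(PSL R n.+1) _).
by apply: slval_inj; rewrite /= !mkSLK veronese_mxM.
Qed.

Lemma rho_psi (g : PSL R 2) (z : CP R 1) :
  psl_act (rho g) (psi z) = psi (psl_act g z).
Proof.
have gz0 : slval (repr g) *m prepr z != 0.
  apply: contraNneq (prepr_neq0 z) => e.
  by rewrite -[prepr z](mulKmx (sl_unit (repr g))) e mulmx0.
have [c c0 ec] := psl_repr (rho_sl (repr g)).
have [d d0 ed] := pclassK (veronese_vec_neq0 n (prepr_neq0 z)).
have [b b0 eb] := pclassK gz0.
rewrite /psl_act /psi ed ec eb veronese_vecZ.
apply: (@pclass_eq _ _ _ _ _ (b ^+ n / (c * d))).
  by rewrite !(mulf_neq0, invr_eq0, expf_neq0).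
rewrite -scalemxAl -scalemxAr !scalerA mkSLK veronese_mx_vec.
by rewrite -mulrA divfK ?mulf_neq0.
Qed.

(* A sequence of loxodromic type in rho(Gamma), whose quasi-projective limit g
   has image psi p. *)
Record loxodromic_sequence (Gamma : set (PSL R 2)) (p : CP R 1)
    (gam : nat -> PSL R 2) (g : QP R n) : Prop := LoxodromicSequence {
  lox_in : forall m, Gamma (gam m);
  lox_distinct : injective gam;
  lox_cvg : (fun m => psl_qp (rho (gam m))) @ \oo --> g;
  lox_divergent : ~ range (@psl_qp R n) g;
  lox_im : qp_im g = [set psi p];
  lox_ker : ~ qp_ker g (psi p) }.

(* Lifts to SL(2,C) of singular value decompositions of the gam m, with
   unitary factors u m converging to ulim. *)
Record singular_decomposition (gam : nat -> PSL R 2) (u a v : nat -> SL R 2)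
    (ulim : SL R 2) : Prop := SingularDecomposition {
  svd_eq : forall m, gam m = \pi_(PSL R 2) (u m * a m * v m)%g;
  svd_unitaryl : forall m, slval (u m) \is unitarymx;
  svd_unitaryr : forall m, slval (v m) \is unitarymx;
  svd_diag : forall m, is_diag_mx (slval (a m));
  svd_sigma : forall m, 0 < slval (a m) 1 1 < slval (a m) 0 0;
  svd_cvg : u @ \oo --> ulim }.

(* The projectivization of the span of the first j standard basis vectors. *)
Definition coordinate_subspace (j : nat) : set (CP R n) :=
  [set x | forall i : 'I_n.+1, (j <= i)%N -> prepr x i 0 = 0].

Definition F_plus (j : nat) (u : SL R 2) : set (CP R n) :=
  psl_act (rho (\pi_(PSL R 2) u)) @` coordinate_subspace j.

(* F_plus depends only on p and not on the sequence nor on its singular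
   decomposition, so the union over all of them is that common value. *)
Definition xi_plus (Gamma : set (PSL R 2)) (j : nat) (p : CP R 1) :
    set (CP R n) :=
  [set x | exists gam g u a v ulim,
    [/\ loxodromic_sequence Gamma p gam g,
        singular_decomposition gam u a v ulim & F_plus j ulim x]].

Definition L_CG_ext (Gamma : set (PSL R 2)) : set (CP R n) :=
  closure (\bigcup_(p in limit_set Gamma) xi_plus Gamma ((n + 2) %/ 2)%N p).

End VeroneseGroup.

Arguments xi_plus {R} n Gamma j p.
Arguments L_CG_ext {R} n Gamma.

(* Main.v *)
(* A divergent sequence in Gamma, rescaled, converges along a subsequence to a rank
   one matrix p r^T; p is its attracting point and ker r = [q] its repelling point.
   In the basis adapted to the singular value decomposition rho of the sequence is
   diagonal with weights s^(n-2i), s -> infinity, so points converging outside the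
   span of the coordinates with 2i >= n have images accumulating only on the
   span of those with 2i <= n.  These spans are the fibres F(q) and F(p) of the
   extended limit set, whence proper discontinuity on its complement.  Conversely
   any point of F(q) and any point of F(p) (after a small perturbation when n is
   even) are dynamically related, so a closed invariant W with properly
   discontinuous complement contains F(p) or F(q).  Applied to limits of the form
   M h (adj M), h in Gamma, whose attracting and repelling points are both p, this
   shows that W contains every F(p), i.e. the whole extended limit set. *)
Require Import Defs.
From mathcomp Require Import all_boot all_order all_algebra.
From mathcomp Require Import complex.
From mathcomp Require Import all_classical all_reals all_analysis.
From mathcomp Require Import zify ring.

Set Implicit Arguments.
Unset Strict Implicit.
Unset Printing Implicit Defensive.
Import Order.TTheory GRing.Theory Num.Theory.
Import numFieldNormedType.Exports.
Local Open Scope classical_set_scope.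
Local Open Scope ring_scope.
Local Open Scope quotient_scope.
Local Open Scope sesquilinear_scope.

(** * Convergence of matrix sequences *)

(** Limits are taken in the space of 2 x 2 matrices. For determinant 1 the adjugate is the inverse,
    and it is polynomial, so if a rescaled sequence converges to a rank one M, its inverses with the
    same scalars converge to adj M, which exchanges attracting and repelling point. Products and
    inverses of sequences thus become matrix algebra. The extended limit set is defined by sequences
    of loxodromic type only, whereas the limits M h (adj M) are nilpotent, hence never of this type.
    It is therefore rewritten without that condition: right multiplication by a suitable h in Gamma
    keeps the attracting point and moves the repelling point away from it. The number floor((n+2)/2)
    counts the coordinates i = 0, ..., n with 2i <= n, those of weight s^(n-2i) >= 1. For even n the
    middle coordinate has weight 1 and is left unchanged by the diagonal part, so the middle
    coordinates of two points to be related have to be matched; this is the origin of the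
    perturbation. *)

Section EntrywiseConvergence.
Variable K : numFieldType.
Implicit Types (u v : nat -> K) (a b : K).

(* Convergence is spelled out with the norm, and matrices converge entrywise:
   in this form it does not depend on which of the (convertible) topologies of
   R[i] is inferred. *)
Definition ncvg u a : Prop :=
  forall e, 0 < e -> exists N, forall k, (N <= k)%N -> `|a - u k| < e.

Lemma ncvgP u a : ncvg u a <-> u @ \oo --> a.
Proof.
split=> [h|/cvgrPdist_lt h e e0].
  apply/cvgrPdist_lt => e e0; have [N hN] := h e e0.
  by exists N => // k /= /hN.
by have [N _ hN] := h e e0; exists N => k Nk; exact: hN.
Qed.

Lemma ncvg_cst a : ncvg (fun=> a) a.
Proof. by apply/ncvgP; exact: cvg_cst. Qed.

Lemma ncvgD u v a b : ncvg u a -> ncvg v b -> ncvg (fun k => u k + v k) (a + b).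
Proof. by move=> /ncvgP ua /ncvgP vb; apply/ncvgP; exact: cvgD. Qed.

Lemma ncvgM u v a b : ncvg u a -> ncvg v b -> ncvg (fun k => u k * v k) (a * b).
Proof. by move=> /ncvgP ua /ncvgP vb; apply/ncvgP; exact: cvgM. Qed.

Lemma ncvgN u a : ncvg u a -> ncvg (fun k => - u k) (- a).
Proof. by move=> /ncvgP ua; apply/ncvgP; exact: cvgN. Qed.

Lemma ncvgV u a : a != 0 -> ncvg u a -> ncvg (fun k => (u k)^-1) a^-1.
Proof. by move=> a0 /ncvgP ua; apply/ncvgP; exact: cvgV. Qed.

Lemma ncvgX u a n : ncvg u a -> ncvg (fun k => u k ^+ n) (a ^+ n).
Proof.
move=> ua; elim: n => [|n ih]; first exact: ncvg_cst.
rewrite exprS (_ : (fun k => _) = (fun k => u k * u k ^+ n)); first exact: ncvgM.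
by apply/funext => k; rewrite exprS.
Qed.

Lemma ncvg_sum (I : Type) (r : seq I) (F : I -> nat -> K) (c : I -> K) :
  (forall i, ncvg (F i) (c i)) ->
  ncvg (fun k => \sum_(i <- r) F i k) (\sum_(i <- r) c i).
Proof.
move=> Fc; elim: r => [|l r ih].
  rewrite big_nil (_ : (fun k => _) = fun=> 0); first exact: ncvg_cst.
  by apply/funext => k; rewrite big_nil.
rewrite big_cons (_ : (fun k => _) = fun k => F l k + \sum_(i <- r) F i k).
  exact: ncvgD.
by apply/funext => k; rewrite big_cons.
Qed.

Lemma ncvg_unique u a b : ncvg u a -> ncvg u b -> a = b.
Proof.
move=> ua ub; apply/eqP; rewrite -subr_eq0; apply/negPn/negP => ab.
have h0 : 0 < `|a - b| / 2 by rewrite divr_gt0 ?normr_gt0 ?ltr0n.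
have [N hN] := ua _ h0; have [M hM] := ub _ h0.
have := ltrD (hN _ (leq_maxl N M)) (hM _ (leq_maxr N M)).
rewrite -splitr => /lt_geF/negP; apply.
by rewrite (le_trans (ler_distD (u (maxn N M)) _ _)) // lerD2l distrC.
Qed.

Lemma ncvg_neq0 u a : a != 0 -> ncvg u a ->
  exists N, forall k, (N <= k)%N -> u k != 0.
Proof.
rewrite -normr_gt0 => a0 /(_ _ a0)[N hN]; exists N => k /hN.
by apply: contraTneq => ->; rewrite subr0 ltxx.
Qed.

Lemma ncvg0_norm u v : (forall k, `|v k| <= `|u k|) -> ncvg u 0 -> ncvg v 0.
Proof.
move=> vu u0 e /u0[N hN]; exists N => k /hN.
by rewrite !sub0r !normrN; exact: le_lt_trans.
Qed.

Definition mcvg m n (X : nat -> 'M[K]_(m, n)) (L : 'M[K]_(m, n)) : Prop :=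
  forall i j, ncvg (fun k => X k i j) (L i j).

Lemma mcvg_cst m n (A : 'M[K]_(m, n)) : mcvg (fun=> A) A.
Proof. by move=> i j; exact: ncvg_cst. Qed.

Lemma mcvgM m n p (X : nat -> 'M[K]_(m, n)) (Y : nat -> 'M[K]_(n, p)) A B :
  mcvg X A -> mcvg Y B -> mcvg (fun k => X k *m Y k) (A *m B).
Proof.
move=> XA YB i j; rewrite mxE.
rewrite (_ : (fun k => _) = (fun k => \sum_l X k i l * Y k l j)).
  by apply: ncvg_sum => l; apply: ncvgM; [exact: XA | exact: YB].
by apply/funext => k; rewrite mxE.
Qed.

Lemma mcvgZ m n (c : nat -> K) (X : nat -> 'M[K]_(m, n)) a A :
  ncvg c a -> mcvg X A -> mcvg (fun k => c k *: X k) (a *: A).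
Proof.
move=> ca XA i j; rewrite mxE (_ : (fun k => _) = (fun k => c k * X k i j)).
  by apply: ncvgM => //; exact: XA.
by apply/funext => k; rewrite mxE.
Qed.

Lemma mcvg_unique m n (X : nat -> 'M[K]_(m, n)) A B :
  mcvg X A -> mcvg X B -> A = B.
Proof. by move=> XA XB; apply/matrixP => i j; apply: ncvg_unique (XB i j). Qed.

Lemma mcvg_ext m n (X Y : nat -> 'M[K]_(m, n)) A :
  X =1 Y -> mcvg X A -> mcvg Y A.
Proof. by move=> /funext ->. Qed.

Lemma mcvg_near m n (X : nat -> 'M[K]_(m, n)) A e : 0 < e -> mcvg X A ->
  exists N, forall k, (N <= k)%N -> forall i j, `|A i j - X k i j| < e.
Proof.
move=> e0 XA.
have /choice[N hN] (ij : 'I_m * 'I_n) : exists N, forall k, (N <= k)%N ->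
  `|A ij.1 ij.2 - X k ij.1 ij.2| < e by exact: XA.
exists (\max_ij N ij)%N => k Nk i j; apply: (hN (i, j)).
exact: leq_trans (leq_bigmax _) Nk.
Qed.

Lemma mcvg_neq0 m n (X : nat -> 'M[K]_(m, n)) A : A != 0 -> mcvg X A ->
  exists N, forall k, (N <= k)%N -> X k != 0.
Proof.
move=> A0 XA; have [i [j Aij]] : exists i j, A i j != 0.
  apply: contrapT => h; case/eqP: A0; apply/matrixP => i j; rewrite mxE.
  by apply/eqP/negPn/negP => Aij; apply: h; exists i, j.
have [N hN] := ncvg_neq0 Aij (XA i j).
by exists N => k /hN; apply: contraNneq => ->; rewrite mxE.
Qed.

Lemma mcvg_mx22 (X : nat -> 'M[K]_2) A : mcvg X A ->
  ncvg (fun k => \det (X k)) (\det A).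
Proof.
move=> XA; rewrite det_mx22.
rewrite (_ : (fun k => _) = fun k => X k 0 0 * X k 1 1 + - (X k 0 1 * X k 1 0)).
  by apply: ncvgD; [|apply: ncvgN]; apply: ncvgM; exact: XA.
by apply/funext => k; rewrite det_mx22.
Qed.

(** Continuity of the inverse in SL(2,C), in a form that survives rescaling to a singular limit. *)
Lemma mcvg_adj22 (X : nat -> 'M[K]_2) A : mcvg X A ->
  mcvg (fun k => \adj (X k)) (\adj A).
Proof.
have E (B : 'M[K]_2) i j : (\adj B) i j = (-1) ^+ (j + i) * B (lift j 0) (lift i 0).
  by rewrite mxE /cofactor det_mx11 !mxE.
move=> XA i j; rewrite E.
rewrite (_ : (fun k => _) = fun k => (-1) ^+ (j + i) * X k (lift j 0) (lift i 0)).
  by apply: ncvgM; [exact: ncvg_cst | exact: XA].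
by apply/funext => k; rewrite E.
Qed.

(** Stands in for a subsequence: f need be neither increasing nor injective, as limits only require
    it to tend to infinity. Where distinct terms matter, [injective_extract] restores them. *)
Definition cofinal_seq (f : nat -> nat) := forall m, (m <= f m)%N.

Lemma cofinal_comp f g : cofinal_seq f -> cofinal_seq g -> cofinal_seq (f \o g).
Proof. by move=> cf cg m; apply: leq_trans (cg m) (cf _). Qed.

Lemma cofinal_addn N : cofinal_seq (addn N).
Proof. by move=> m; exact: leq_addl. Qed.

Lemma cofinal_ncvg f u a : cofinal_seq f -> ncvg u a -> ncvg (u \o f) a.
Proof.
move=> cf ua e /ua[N hN]; exists N => k Nk; apply: hN.
exact: leq_trans Nk (cf k).
Qed.

Lemma cofinal_mcvg m n f (X : nat -> 'M[K]_(m, n)) A :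
  cofinal_seq f -> mcvg X A -> mcvg (X \o f) A.
Proof. by move=> cf XA i j; apply: (cofinal_ncvg cf (XA i j)). Qed.

Lemma cofinal_extract (T : Type) (P : nat -> nat -> T -> Prop) :
  (forall k N, exists m x, (N <= m)%N /\ P k m x) ->
  exists (f : nat -> nat) (x : nat -> T), cofinal_seq f /\ forall k, P k (f k) (x k).
Proof.
move=> h.
have /choice[F FP] k : exists p : nat * T, (k <= p.1)%N /\ P k p.1 p.2.
  by have [m [x hx]] := h k k; exists (m, x).
by exists (fun k => (F k).1), (fun k => (F k).2); split=> k; have [] := FP k.
Qed.

End EntrywiseConvergence.

(** * Complex sequences and extraction of limits *)

Section ComplexSequences.
Variable R : realType.
Local Notation C := R[i].

Lemma ncvg_conj (u : nat -> C) (a : C) : ncvg u a -> ncvg (fun k => (u k)^*) a^*.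
Proof.
move=> ua e /ua[N hN]; exists N => k /hN.
by rewrite -rmorphB norm_conjC.
Qed.

Lemma mcvg_tr m n (X : nat -> 'M[C]_(m, n)) A :
  mcvg X A -> mcvg (fun k => (X k)^t*) (A^t*).
Proof.
move=> XA i j; rewrite !mxE (_ : (fun k => _) = (fun k => (X k j i)^*)).
  exact/ncvg_conj/XA.
by apply/funext => k; rewrite !mxE.
Qed.

Lemma real_ncvg_invSn : ncvg (fun k => k.+1%:R^-1 : R) 0.
Proof.
move=> e e0; have [N _ hN] := near_infty_natSinv_lt (PosNum e0).
exists N => k Nk; rewrite sub0r normrN ger0_norm ?invr_ge0 ?ler0n //.
exact: (hN k Nk).
Qed.

Lemma normc_real (x : R) : `|x%:C%C : C| = `|x|%:C%C.
Proof. by rewrite normc_def /= expr0n /= addr0 sqrtr_sqr. Qed.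

Lemma ncvg_complex (x y : nat -> R) a b : ncvg x a -> ncvg y b ->
  ncvg (fun k => (x k +i* y k)%C : C) (a +i* b)%C.
Proof.
move=> xa yb e e0.
(* In the partial order of [R[i]], 0 < e forces e to be real. *)
have eR : e = (complex.Re e)%:C%C.
  by move: e0; case: e => s t; rewrite ltcE /= => /andP[/eqP ->].
have h0 : 0 < complex.Re e / 2.
  by rewrite divr_gt0 ?ltr0n //; move: e0; rewrite eR ltcR.
have [N hN] := xa _ h0; have [M hM] := yb _ h0.
exists (maxn N M) => k; rewrite geq_max => /andP[Nk Mk].
rewrite [_ - _]complexE /= (le_lt_trans (ler_normD _ _)) // normrM normc_real.
have -> : `|'i%C : C| = 1 by rewrite complexiE normCi.
rewrite mul1r normc_real -rmorphD /= [ltRHS]eR ltcR [ltRHS]splitr.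
by rewrite ltrD ?hN ?hM.
Qed.

Lemma ncvg_invSn : ncvg (fun k => k.+1%:R^-1 : C) 0.
Proof.
rewrite (_ : (fun k => _) = fun k => (k.+1%:R^-1 +i* 0)%C).
  by apply: ncvg_complex; [exact: real_ncvg_invSn | exact: ncvg_cst].
by apply/funext => k; rewrite complexr0 fmorphV rmorph_nat.
Qed.

Lemma real_bounded_extract (x : nat -> R) M : (forall k, `|x k| <= M) ->
  exists f a, cofinal_seq f /\ ncvg (x \o f) a.
Proof.
move=> xM.
have [a [_ ha]] : `[- M, M]%classic `&` cluster (x @ \oo) !=set0.
  apply: segment_compact; exists 0 => // k _ /=.
  by rewrite in_itv /= -ler_norml.
have h k N : exists m (t : unit), (N <= m)%N /\ `|a - x m| < k.+1%:R^-1.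
  have k0 : 0 < k.+1%:R^-1 :> R by rewrite invr_gt0 ltr0n.
  have xN : (x @ \oo) (x @` [set m | (N <= m)%N]) by exists N => // m Nm; exists m.
  have [_ [[m /= Nm <-] am]] := ha _ _ xN (nbhsx_ballx a _ k0).
  by exists m, tt; split; [exact: Nm | exact: am].
have [f [_ [cf hf]]] := cofinal_extract (P := fun k m _ => `|a - x m| < k.+1%:R^-1) h.
exists f, a; split=> // e /real_ncvg_invSn[N hN]; exists N => k /hN.
rewrite sub0r normrN ger0_norm ?invr_ge0 ?ler0n //; exact: lt_trans (hf k).
Qed.

Lemma bounded_extract (z : nat -> C) M : (forall k, `|z k| <= M%:C%C) ->
  exists f a, cofinal_seq f /\ ncvg (z \o f) a.
Proof.
move=> zM.
have hRe k : `|complex.Re (z k)| <= M.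
  by rewrite -lecR (le_trans (normc_ge_Re _)).
have [f [a [cf fa]]] := real_bounded_extract hRe.
have hIm k : `|complex.Im (z (f k))| <= M.
  rewrite -lecR (le_trans _ (zM (f k))) //.
  have := normc_ge_Re (z (f k) * 'i%C); rewrite ReiNIm normrN normrM.
  by have -> : `|'i%C : C| = 1 by [rewrite complexiE normCi]; rewrite mulr1.
have [g [b [cg gb]]] := real_bounded_extract hIm.
exists (f \o g), (a +i* b)%C; split; first exact: cofinal_comp.
have := ncvg_complex (cofinal_ncvg cg fa) gb; congr (ncvg _ _).
by apply/funext => k /=; case: (z _).
Qed.

Lemma mbounded_extract m n (X : nat -> 'M[C]_(m, n)) M :
  (forall k i j, `|X k i j| <= M%:C%C) ->
  exists f A, cofinal_seq f /\ mcvg (X \o f) A.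
Proof.
move=> XM.
suff [f [a [cf fa]]] : exists f (a : 'I_m * 'I_n -> C), cofinal_seq f /\
    forall ij, ij \in enum [set: 'I_m * 'I_n]%SET ->
    ncvg (fun k => X (f k) ij.1 ij.2) (a ij).
  exists f, (\matrix_(i, j) a (i, j)); split=> // i j; rewrite mxE.
  by apply: (fa (i, j)); rewrite mem_enum finset.in_setT.
elim: (enum _) => [|ij s [f [a [cf fa]]]].
  by exists id, (fun=> 0); split=> // k.
have [g [b [cg gb]]] := bounded_extract (fun k => XM (f k) ij.1 ij.2).
exists (f \o g), (fun ij' => if ij' == ij then b else a ij').
split=> [|ij' ]; first exact: cofinal_comp.
rewrite in_cons; case: eqVneq => [-> _ //|_ /= /fa]; exact: cofinal_ncvg.
Qed.

End ComplexSequences.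

(** * Topology of projective spaces *)

Lemma nbhs_set_val (T : topologicalType) (A : set T) (x : A) (U : set A) :
  nbhs x U <-> exists2 V, nbhs (set_val x) V & set_val @^-1` V `<=` U.
Proof.
split.
  rewrite nbhsE => -[W [[V oV VW] Wx] WU]; exists V; last by rewrite VW.
  by exists V => //; split=> //; rewrite -VW in Wx.
case=> V xV VU; apply: filterS VU _.
exact: (@initial_continuous A T set_val x).
Qed.

(** A filter that does not cluster at x avoids a neighbourhood of x, hence lives on the finitely
    many terms outside it. Such sets serve as the compact sets on which proper discontinuity is
    tested. *)
Lemma compact_cvg_seq (T : topologicalType) (s : nat -> T) (x : T) :
  s @ \oo --> x -> compact (x |` range s).
Proof.
move=> sx F FF FK; have [cx|nx] := pselect (cluster F x).

  by exists x; split; [left|].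
have [A [V [FA xV AV]]] : exists A V, [/\ F A, nbhs x V & A `&` V = set0].
  apply: contrapT => h; apply: nx => A V FA xV; apply/set0P/negP => /eqP AV.
  by apply: h; exists A, V.
have [N _ hN] := sx _ xV.
have : compact (s @` `I_N) by apply: finite_compact; apply: finite_image; exact: finite_II.
move=> /(_ F FF)[|y [[k kN <-] Fy]]; last by exists (s k); split=> //; right; exists k.
apply: filterS (filterI FA FK) => y [Ay [yx|[k _ ky]]].
  have : (A `&` V) x by split; [rewrite -yx | exact: nbhs_singleton xV].
  by rewrite AV.
exists k => //=; rewrite ltnNge; apply/negP => Nk.
have : (A `&` V) y by split=> //; rewrite -ky; exact: hN.
by rewrite AV.
Qed.

Section ProjectiveTopology.
Variable R : realType.
Local Notation C := R[i].

Lemma nbhs_mxP m n (A : 'M[C]_(m, n)) (U : set 'M[C]_(m, n)) :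
  nbhs A U <-> exists2 e : C, 0 < e &
    [set B : 'M[C]_(m, n) | forall i j, `|A i j - B i j| < e] `<=` U.
Proof.
split=> [/nbhs_ballP[e /= e0 eU]|[e e0 eU]].
  by exists e => // B AB; apply: eU.
by apply/nbhs_ballP; exists e => // B /= [_ AB]; exact: eU.
Qed.

Lemma pclass_prepr m n (x : PM R m n) : pclass (prepr x) = x.
Proof.
rewrite -[RHS]reprK; apply/pi_PM_eqP; exists 1; first exact: oner_neq0.
by rewrite nonzero_mx_insubd ?prepr_neq0 // scale1r.
Qed.

Lemma pclass_cvg m n (X : nat -> 'M[C]_(m.+1, n.+1)) A : A != 0 -> mcvg X A ->
  (fun k => pclass (X k)) @ \oo --> pclass A.
Proof.
move=> A0 XA.
pose ins B : set_type (@nonzero_mx R m n) :=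
  insubd (SigSub (const_mx1_neq0 R m n) : set_type (@nonzero_mx R m n)) B.
suff tc : ins \o X @ \oo --> ins A.
  exact: cvg_comp tc (@pi_continuous _ {eq_quot (@nonzero_mx_equiv R m n)} (ins A)).
move=> U /nbhs_set_val[V]; rewrite nonzero_mx_insubd // => /nbhs_mxP[e e0 eV] VU.
have [N hN] := mcvg_near e0 XA; have [M hM] := mcvg_neq0 A0 XA.
exists (maxn N M) => // k /=; rewrite geq_max => /andP[Nk Mk].
apply: VU; apply: eV; rewrite nonzero_mx_insubd; [exact: hN|exact: hM].
Qed.

(** The projection to projective space is open: the preimage [O] of the set consists of all matrices
    having some multiple close to [prepr x], and multiplication by a fixed c scales distances by
    |c|. *)
Lemma pclass_nbhs m n (x : PM R m n) (e : C) : 0 < e ->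
  nbhs x [set pclass B | B in [set B : 'M[C]_(m.+1, n.+1) |
    B != 0 /\ forall i j, `|prepr x i j - B i j| < e]].
Proof.
move=> e0; set U := (X in nbhs x X).
pose O := [set a : set_type (@nonzero_mx R m n) | exists2 c : C, c != 0 &
  forall i j, `|prepr x i j - c * set_val a i j| < e].
have OU : \pi_(PM R m n) @^-1` U = O.
  apply/seteqP; split=> a /=.
    case=> B [B0 xB] Ba; have [c c0 cE] : exists2 c : C, c != 0 & B = c *: set_val a.
      rewrite -(nonzero_mx_insubd B0); apply/pi_PM_eqP; exact/esym.
    by exists c => // i j; move: (xB i j); rewrite cE mxE.
  case=> c c0 ca; exists (c *: set_val a).
    split=> [|i j]; last by rewrite mxE.
    by rewrite scaler_eq0 negb_or c0; exact: (set_valP a).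
  apply/esym/pi_PM_eqP; exists c => //; rewrite nonzero_mx_insubd //.
  by rewrite scaler_eq0 negb_or c0; exact: (set_valP a).
rewrite nbhsE; exists U => //; split; last first.
  exists (prepr x); last exact: pclass_prepr.
  by split=> [|i j]; rewrite ?prepr_neq0 // subrr normr0.
rewrite /open /= /quotient_open OU openE => a [c c0 ca].
apply/nbhs_set_val.
have c1 : 0 < `|c| by rewrite normr_gt0.
(* The radius for each entry is the remaining margin divided by |c|. It is taken in R, whose order
   is total, so that a minimum over the entries makes sense. *)
have /choice[d hd] (ij : 'I_m.+1 * 'I_n.+1) : exists d : R, 0 < d /\
    forall b : C, `|set_val a ij.1 ij.2 - b| < d%:C%C -> `|prepr x ij.1 ij.2 - c * b| < e.
  have := ca ij.1 ij.2; set s := prepr x _ _; set t := set_val a _ _ => st.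
  have /complex_realP[d dE] : (e - `|s - c * t|) / `|c| \is Num.real.
    by rewrite ger0_real // divr_ge0 ?subr_ge0 1?ltW.
  exists d; split=> [|b]; first by rewrite -ltcR -dE divr_gt0 ?subr_gt0.
  rewrite -dE ltr_pdivlMr // mulrC -normrM mulrBr ltrBrDl.
  by apply: le_lt_trans; exact: ler_distD.
exists [set B : 'M[C]_(m.+1, n.+1) |
    forall i j, `|set_val a i j - B i j| < (\big[Num.min/1]_ij d ij)%:C%C].
  apply/nbhs_mxP; exists (\big[Num.min/1]_ij d ij)%:C%C => //.
  rewrite ltcR; apply/bigmin_gtP; split=> [|ij _]; first exact: ltr01.
  by have [] := hd ij.
move=> b /= ab; exists c => // i j; apply: (hd (i, j)).2.
by rewrite (lt_le_trans (ab i j)) // lecR; exact: bigmin_le.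
Qed.

(** Replaces clustering in the quotient by convergence of suitably scaled representatives, so that
    the dynamics can be computed on matrices. *)
Lemma cluster_lift m n (s : nat -> PM R m n) (x : PM R m n) :
  cluster (s @ \oo) x -> exists f X,
    [/\ cofinal_seq f, mcvg X (prepr x), forall k, X k != 0 &
        forall k, pclass (X k) = s (f k)].
Proof.
move=> sx.
have h k N : exists l B, (N <= l)%N /\ [/\ B != 0, pclass B = s l &
    forall i j, `|prepr x i j - B i j| < k.+1%:R^-1].
  have k0 : 0 < k.+1%:R^-1 :> C by rewrite invr_gt0 ltr0n.
  have sN : (s @ \oo) (s @` [set l | (N <= l)%N]) by exists N => // l Nl; exists l.
  have [_ [[l /= Nl <-] [B [B0 xB] Bl]]] := sx _ _ sN (pclass_nbhs x k0).
  by exists l, B; split; [exact: Nl | split].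
have [f [X [cf hX]]] := cofinal_extract
  (P := fun k l B => [/\ B != 0, pclass B = s l &
    forall i j, `|prepr x i j - B i j| < k.+1%:R^-1]) h.
exists f, X; split=> // [i j|k|k]; last 2 first.
- by have [] := hX k.
- by have [] := hX k.
move=> e /ncvg_invSn[N hN]; exists N => k /hN.
rewrite sub0r normrN ger0_norm ?invr_ge0 ?ler0n //.
by have [_ _ /(_ i j)] := hX k; exact: lt_trans.
Qed.

Lemma compact_lift m n (K : set (PM R m n)) (s : nat -> PM R m n) :
  compact K -> (forall k, K (s k)) -> exists f X A,
    [/\ cofinal_seq f, mcvg X A, A != 0 /\ K (pclass A), forall k, X k != 0 &
        forall k, pclass (X k) = s (f k)].
Proof.
move=> cK Ks; have [|x [Kx sx]] := cK (s @ \oo) _; first by exists 0 => // k _; exact: Ks.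
have [f [X [cf Xx X0 Xs]]] := cluster_lift sx.
by exists f, X, (prepr x); split=> //; rewrite prepr_neq0 pclass_prepr.
Qed.

End ProjectiveTopology.
(** * Singular values in SL(2,C) *)

Section TwoByTwo.
Variable K : comNzRingType.

Lemma ord2_cases (P : 'I_2 -> Prop) : P 0 -> P 1 -> forall i, P i.
Proof.
move=> P0 P1 [[|[|//]] h]; first by rewrite (_ : Ordinal h = 0) //; exact: val_inj.
by rewrite (_ : Ordinal h = 1) //; exact: val_inj.
Qed.

Lemma big_ord2 (F : 'I_2 -> K) : \sum_i F i = F 0 + F 1.
Proof.
rewrite !big_ord_recl big_ord0 addr0; congr (_ + F _); exact: val_inj.
Qed.

Lemma mx22P (A B : 'M[K]_2) : A 0 0 = B 0 0 -> A 0 1 = B 0 1 ->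
  A 1 0 = B 1 0 -> A 1 1 = B 1 1 -> A = B.
Proof.
by move=> *; apply/matrixP; apply: ord2_cases; apply: ord2_cases.
Qed.

Lemma mulmx2E m p (A : 'M[K]_(m, 2)) (B : 'M[K]_(2, p)) i j :
  (A *m B) i j = A i 0 * B 0 j + A i 1 * B 1 j.
Proof. by rewrite mxE big_ord2. Qed.

Definition diag2 (a b : K) : 'M[K]_2 :=
  \matrix_(i, j) (if i == j then if i == 0 then a else b else 0).

(** The Weyl element of SL(2): it exchanges the two coordinate lines, and with them attracting and
    repelling data. *)
Definition flip_mx : 'M[K]_2 :=
  \matrix_(i, j) (if i == j then 0 else if i == 0 then 1 else -1).

Lemma diag2E a b : ((diag2 a b) 0 0 = a) * ((diag2 a b) 1 1 = b) *
  ((diag2 a b) 0 1 = 0) * ((diag2 a b) 1 0 = 0).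
Proof. by rewrite !mxE. Qed.

Lemma flip_mxE : (flip_mx 0 0 = 0) * (flip_mx 1 1 = 0) * (flip_mx 0 1 = 1) *
  (flip_mx 1 0 = -1).
Proof. by rewrite !mxE. Qed.

Lemma is_diag2P (A : 'M[K]_2) : is_diag_mx A -> A = diag2 (A 0 0) (A 1 1).
Proof.
move=> /is_diag_mxP dA.
by apply: mx22P; rewrite ?diag2E // dA.
Qed.

Lemma adj22 (A : 'M[K]_2) : ((\adj A) 0 0 = A 1 1) * ((\adj A) 1 1 = A 0 0) *
  ((\adj A) 0 1 = - A 0 1) * ((\adj A) 1 0 = - A 1 0).
Proof.
have l0 : lift 0 0 = 1 :> 'I_2 by exact: val_inj.
have l1 : lift 1 0 = 0 :> 'I_2 by exact: val_inj.
rewrite !mxE /cofactor !det_mx11 !mxE.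
rewrite !l0 !l1; split; [split; [split|]|].
- by rewrite -[LHS]/((-1) ^+ 0 * _) expr0 mul1r.
- by rewrite -[LHS]/((-1) ^+ 2 * _) sqrrN expr1n mul1r.
- by rewrite -[LHS]/((-1) ^+ 1 * _) expr1 mulN1r.
- by rewrite -[LHS]/((-1) ^+ 1 * _) expr1 mulN1r.
Qed.

Lemma det22 (A : 'M[K]_2) : \det A = A 0 0 * A 1 1 - A 0 1 * A 1 0.
Proof.
rewrite (expand_det_row _ ord0) !big_ord_recl big_ord0 addr0 /cofactor.
rewrite !det_mx11 !mxE /= !expr0 expr1 mul1r mulN1r mulrN.
by congr (_ * A _ _ - A _ _ * A _ _); apply: val_inj.
Qed.

Lemma adj22M (A B : 'M[K]_2) : \adj (A *m B) = \adj B *m \adj A.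
Proof. by apply: mx22P; rewrite !mulmx2E !adj22 !mulmx2E; ring. Qed.

Lemma adj22Z c (A : 'M[K]_2) : \adj (c *: A) = c *: \adj A.
Proof. by apply: mx22P; rewrite ?[in LHS]adj22 [RHS]mxE ?adj22 !mxE ?mulrN. Qed.

Lemma adj22K (A : 'M[K]_2) : \adj (\adj A) = A.
Proof. by apply: mx22P; rewrite !adj22 ?opprK. Qed.

End TwoByTwo.

Lemma diag2M (K : comNzRingType) (a b c d : K) :
  diag2 a b *m diag2 c d = diag2 (a * c) (b * d).
Proof. by apply: mx22P; rewrite !mulmx2E !diag2E; ring. Qed.

Lemma diag2_1 (K : comNzRingType) : diag2 1 1 = 1%:M :> 'M[K]_2.
Proof. by apply: mx22P; rewrite !mxE. Qed.

Lemma det_diag2 (K : comNzRingType) (a b : K) : \det (diag2 a b) = a * b.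
Proof. by rewrite det22 !diag2E mulr0 subr0. Qed.

Lemma diag2_tC (C : numClosedFieldType) (a b : C) :
  (diag2 a b)^t* = diag2 a^* b^*.
Proof. by apply: mx22P; rewrite !mxE //= rmorph0. Qed.

Lemma flip_tC (C : numClosedFieldType) : (flip_mx C)^t* = \adj (flip_mx C).
Proof.
apply: mx22P; rewrite !adj22 !flip_mxE !mxE //= ?rmorph0 ?rmorphN ?rmorph1 ?oppr0 //.
by rewrite opprK.
Qed.

Lemma conj_invr_unit (C : numClosedFieldType) (c : C) :
  c * c^* = 1 -> c^-1 * (c^-1)^* = 1.
Proof. by rewrite fmorphV -invfM => ->; rewrite invr1. Qed.

Lemma trmxC_mul (C : numClosedFieldType) m n p (A : 'M[C]_(m, n)) (B : 'M[C]_(n, p)) :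
  (A *m B)^t* = B^t* *m A^t*.
Proof. by rewrite trmx_mul map_mxM. Qed.

Lemma trmxC_congr (C : numClosedFieldType) m n p (A : 'M[C]_(m, n)) (B : 'M[C]_(n, p)) H :
  A *m B *m H *m (A *m B)^t* = A *m (B *m H *m B^t*) *m A^t*.
Proof. by rewrite trmxC_mul !mulmxA. Qed.

Lemma trmxC_gram (C : numClosedFieldType) m n p (A : 'M[C]_(m, n)) (B : 'M[C]_(n, p)) :
  A *m B *m (A *m B)^t* = A *m (B *m B^t*) *m A^t*.
Proof. by rewrite trmxC_mul !mulmxA. Qed.

Lemma trmxC_gramZ (C : numClosedFieldType) m n (c : C) (A : 'M[C]_(m, n)) :
  (c *: A) *m (c *: A)^t* = (c * c^*) *: (A *m A^t*).
Proof. by rewrite linearZ map_mxZ /= -scalemxAl -scalemxAr scalerA. Qed.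

Section SingularValues.
Variable R : realType.
Local Notation C := R[i].

Lemma sl_adj (A : SL R 2) : slval (A^-1)%g = \adj (slval A).
Proof.
rewrite -[RHS]mul1mx -(mulVmx (sl_unit A)) -mulmxA mul_mx_adj slP.
by rewrite mul_mx_scalar scale1r.
Qed.

Lemma slM k (A B : SL R k) : slval (A * B)%g = slval A *m slval B.
Proof. by []. Qed.

Lemma slV_unitary (u : SL R 2) : slval u \is unitarymx -> slval (u^-1)%g = (slval u)^t*.
Proof. by move=> uU; rewrite -invmx_unitary. Qed.

Fact det_flip_mx : \det (flip_mx C) = 1.
Proof. by rewrite det22 !flip_mxE mul0r sub0r mul1r opprK. Qed.

Definition flip : SL R 2 := mkSL det_flip_mx.

Lemma flip_unitary : slval flip \is unitarymx.
Proof.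
apply/unitarymxP; rewrite mkSLK flip_tC mul_mx_adj det22 !flip_mxE.
by rewrite mul0r sub0r mul1r opprK.
Qed.

Lemma unitary_entry k (u : 'M[C]_k) i j : u \is unitarymx -> `|u i j| <= 1.
Proof.
move=> /unitarymxP/matrixP/(_ i i); rewrite !mxE eqxx (bigD1 j) //= !mxE -normCK.
move=> e; have : `|u i j| ^+ 2 <= true%:R.
  by rewrite -e lerDl sumr_ge0 // => l _; rewrite !mxE mul_conjC_ge0.
by rewrite expr_le1.
Qed.

(** The spectral theorem diagonalizes A A^* by a unitary matrix, whose inverse becomes u; the square
    roots of the eigenvalues give a, and v = a^-1 u^-1 A is then unitary. The extra care is to keep
    all three factors of determinant 1. *)
Lemma svd_SL2 (A : SL R 2) : exists u a v : SL R 2,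
  [/\ A = (u * a * v)%g, slval u \is unitarymx, slval v \is unitarymx,
      is_diag_mx (slval a) & 0 < slval a 1 1 <= slval a 0 0].
Proof.
pose H := slval A *m (slval A)^t*.
have HH : H^t* = H by rewrite /H trmxC_mul trmxCK.
have /orthomx_spectralP : H \is normalmx by apply/normalmxP; rewrite HH.
set P := spectralmx H; set d := spectral_diag H => HP.
have PU : P \is unitarymx := spectral_unitarymx H.
have [Q QU [x [y [QHQ yx]]]] : exists2 Q : 'M[C]_2, Q \is unitarymx &
    exists x y : C, Q *m H *m Q^t* = diag2 x y /\ y <= x.
  have PHP : P *m H *m P^t* = diag2 (d 0 0) (d 0 1).
    rewrite HP !mulmxA mulmxV ?unitarymx_unit // mul1mx -mulmxA.
    rewrite (unitarymxP PU) mulmx1; apply: mx22P; rewrite !mxE //=.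
  have dge0 i : 0 <= d 0 i.
    have -> : d 0 i = (P *m H *m P^t*) i i.
      by rewrite PHP; elim/ord2_cases: i; rewrite diag2E.
    rewrite /H -trmxC_gram mxE sumr_ge0 // => l _.
    by rewrite !mxE mul_conjC_ge0.
  have /orP[dd|dd] : (d 0 1 <= d 0 0) || (d 0 0 <= d 0 1).
    by apply: real_leVge; rewrite ger0_real.
    by exists P => //; exists (d 0 0), (d 0 1).
  (* The eigenvalues come in the wrong order and are swapped. *)
  exists (flip_mx C *m P); first exact: (mul_unitarymx flip_unitary PU).
  exists (d 0 1), (d 0 0); split=> //.
  rewrite (trmxC_congr (flip_mx C) P H) PHP flip_tC.
  by apply: mx22P; rewrite !mulmx2E !adj22 !flip_mxE !diag2E; ring.
have detQ : \det Q * (\det Q)^* = 1.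
  have : \det (Q *m Q^t*) = 1 by rewrite (unitarymxP QU) det1.
  by rewrite det_mulmx det_map_mx det_tr.
have detQ0 : \det Q != 0.
  by apply: contra_eq_neq detQ => ->; rewrite mul0r eq_sym oner_neq0.
(* A diagonal phase brings the determinant of Q to 1; conjugating a diagonal matrix by it changes
   nothing. *)
pose D := diag2 (\det Q)^-1 1.
have cV : (\det Q)^-1 * (\det Q)^-1^* = 1.
  exact: conj_invr_unit.
have DD : D *m D^t* = 1%:M.
  by rewrite diag2_tC diag2M rmorph1 mulr1 cV diag2_1.
have dQ : \det (D *m Q) = 1.
  by rewrite det_mulmx det_diag2 mulr1 mulVf.
pose q := mkSL dQ.
have qU : slval q \is unitarymx.
  by apply: mul_unitarymx QU; apply/unitarymxP.
pose B := slval q *m slval A.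
have BB : B *m B^t* = diag2 x y.
  have -> : B *m B^t* = D *m (Q *m H *m Q^t*) *m D^t*.
    by rewrite /B mkSLK trmxC_gram -/H trmxC_congr.
  by rewrite QHQ diag2_tC !diag2M rmorph1 mulr1 mul1r mulrAC cV mul1r.
have detB : \det B = 1 by rewrite /B det_mulmx !slP mulr1.
have xy1 : x * y = 1.
  have : \det (diag2 x y) = 1.
    by rewrite -BB det_mulmx det_map_mx det_tr detB rmorph1 mulr1.
  by rewrite det_diag2.
have ge0 i : 0 <= diag2 x y i i.
  by rewrite -BB mxE sumr_ge0 // => l _; rewrite !mxE mul_conjC_ge0.
have x0 : 0 <= x by have := ge0 0; rewrite diag2E.
have y0 : 0 <= y by have := ge0 1; rewrite diag2E.
(* As x y = 1, also s t = 1, so [diag2 t s] is the inverse of [diag2 s t]. *)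
pose s := sqrtC x; pose t := sqrtC y.
have s0 : 0 <= s by rewrite sqrtC_ge0.
have t0 : 0 <= t by rewrite sqrtC_ge0.
have sC : s^* = s by apply/CrealP; rewrite ger0_real.
have tC : t^* = t by apply/CrealP; rewrite ger0_real.
have st : s * t = 1 by rewrite -rootCMl // xy1 sqrtC1.
have tn0 : t != 0 by apply: contra_eq_neq st => ->; rewrite mulr0 eq_sym oner_neq0.
have da : \det (diag2 s t) = 1 by rewrite det_diag2.
have dv : \det (diag2 t s *m B) = 1.
  by rewrite det_mulmx detB mulr1 det_diag2 mulrC.
exists (q^-1)%g, (mkSL da), (mkSL dv); split.
- apply: slval_inj; rewrite !slM !mkSLK.
  have -> : slval q^-1%g *m diag2 s t *m (diag2 t s *m B) =
     slval q^-1%g *m (diag2 s t *m diag2 t s) *m B by rewrite !mulmxA.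
  have -> : diag2 s t *m diag2 t s = 1%:M.
    by rewrite diag2M (mulrC t) st diag2_1.
  by rewrite mulmx1 /B mulmxA -slM mulVg mul1mx.
- by rewrite (slV_unitary qU) (trmxC_unitary (slval q)).
- apply/unitarymxP; rewrite mkSLK trmxC_gram.
  rewrite BB -[x]sqrtCK -[y]sqrtCK -/s -/t diag2_tC tC sC !diag2M -diag2_1.
  have ts : t * s = 1 by rewrite mulrC.
  by rewrite !expr2 !mulrA ts st !mul1r ts st.
- by apply/is_diag_mxP => i j ij; rewrite mkSLK mxE -val_eqE (negPf ij).
- by rewrite !mkSLK !diag2E lt_def tn0 t0 ler_sqrtC.
Qed.

End SingularValues.

(** * Sequences of singular value decompositions and discreteness *)

Section SingularSequences.
Variable R : realType.
Local Notation C := R[i].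
Implicit Types (G : set (PSL R 2)) (A u a v : nat -> SL R 2).

Lemma sl_cvgP k (s : nat -> SL R k) (S : SL R k) :
  s @ \oo --> S <-> mcvg (fun m => slval (s m)) (slval S).
Proof.
split=> [sS i j e e0|sS U /nbhs_set_val[W /nbhs_mxP[e e0 eW] WU]].
  pose W := [set B : SL R k | forall i j, `|slval S i j - slval B i j| < e].
  have : nbhs S W.
    apply/nbhs_set_val.
    exists [set B : 'M[C]_k | forall i j, `|slval S i j - B i j| < e] => //.
    by apply/nbhs_mxP; exists e.
  by move=> /sS[N _ hN]; exists N => m Nm; exact: (hN m Nm).
have [N hN] := mcvg_near e0 sS; exists N => // m /= Nm.
by apply: WU; apply: eW => i j; exact: hN.
Qed.

(** The singular values may coincide here, so that every element has a decomposition; the strict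
    inequality of [svd_sigma] returns far out in a sequence whose smaller singular value tends to
    0. *)
Definition is_svd (A u a v : SL R 2) : Prop :=
  [/\ A = (u * a * v)%g, slval u \is unitarymx, slval v \is unitarymx,
      is_diag_mx (slval a) & 0 < slval a 1 1 <= slval a 0 0].

(** The limit e of the smaller singular value separates the two regimes: e = 0 for divergence, e !=
    0 for convergence in SL(2,C). *)
Record svd_seq A u a v (U V : SL R 2) (e : C) : Prop := SvdSeq {
  svds_svd : forall m, is_svd (A m) (u m) (a m) (v m);
  svds_u : mcvg (fun m => slval (u m)) (slval U);
  svds_v : mcvg (fun m => slval (v m)) (slval V);
  svds_e : ncvg (fun m => slval (a m) 1 1) e }.

Lemma sl_diagE (a : SL R 2) : is_diag_mx (slval a) ->
  slval a = diag2 (slval a 0 0) (slval a 1 1).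
Proof. exact: is_diag2P. Qed.

Lemma sl_diag_det (a : SL R 2) : is_diag_mx (slval a) ->
  slval a 0 0 * slval a 1 1 = 1.
Proof. by move=> da; rewrite -det_diag2 -sl_diagE // slP. Qed.

Lemma sl_diag_le1 (a : SL R 2) : is_diag_mx (slval a) ->
  0 < slval a 1 1 <= slval a 0 0 -> slval a 1 1 <= 1.
Proof.
move=> da /andP[s0 st]; rewrite -(@expr_le1 _ 2) ?(ltW s0) //.
by rewrite -(sl_diag_det da) expr2 ler_pM2r.
Qed.

Lemma svd_seq_cofinal f A u a v U V e : cofinal_seq f -> svd_seq A u a v U V e ->
  svd_seq (A \o f) (u \o f) (a \o f) (v \o f) U V e.
Proof.
move=> cf [sv su sV se]; split=> [m||| ]; first exact: sv.
- exact: (cofinal_mcvg cf su).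
- exact: (cofinal_mcvg cf sV).
- exact: (cofinal_ncvg cf se).
Qed.

Lemma det_lim (s : nat -> SL R 2) (B : 'M[C]_2) :
  mcvg (fun m => slval (s m)) B -> \det B = 1.
Proof.
move=> /mcvg_mx22 h; apply: ncvg_unique h _.
by rewrite (_ : (fun _ => _) = fun=> 1) ?slP; [exact: ncvg_cst | apply/funext => m; rewrite slP].
Qed.

Lemma unitary_extract (s : nat -> SL R 2) : (forall m, slval (s m) \is unitarymx) ->
  exists f S, cofinal_seq f /\ mcvg (fun m => slval (s (f m))) (slval S).
Proof.
move=> sU; have [|f [S [cf fS]]] := @mbounded_extract R 2 2 (fun m => slval (s m)) 1.
  by move=> k i j; exact: unitary_entry.
by exists f, (mkSL (det_lim fS)).
Qed.

Lemma svd_seq_extract A u a v : (forall m, is_svd (A m) (u m) (a m) (v m)) ->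
  exists f U V e, cofinal_seq f /\ svd_seq (A \o f) (u \o f) (a \o f) (v \o f) U V e.
Proof.
move=> sv.
have [f [U [cf fU]]] : exists f U, cofinal_seq f /\ mcvg (fun m => slval (u (f m))) (slval U).
  by apply: unitary_extract => m; have [] := sv m.
have [g [V [cg gV]]] : exists g V, cofinal_seq g /\
    mcvg (fun m => slval (v (f (g m)))) (slval V).
  by apply: unitary_extract (fun m => v (f m)) _ => m; have [] := sv (f m).
have [|h [e [ch he]]] := @bounded_extract R (fun m => slval (a (f (g m))) 1 1) 1.
  move=> m; have [_ _ _ da sa] := sv (f (g m)).
  by rewrite gtr0_norm; [exact: sl_diag_le1 da sa | case/andP: sa].
exists (f \o (g \o h)), U, V, e; split.
  by apply: cofinal_comp => //; exact: cofinal_comp.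
split=> [m|||].
- exact: sv.
- exact: (cofinal_mcvg (cofinal_comp cg ch) fU).
- exact: (cofinal_mcvg ch gV).
- exact: he.
Qed.

Lemma svd_extract A : exists f u a v U V e,
  cofinal_seq f /\ svd_seq (A \o f) u a v U V e.
Proof.
have /choice[F hF] m : exists t : SL R 2 * SL R 2 * SL R 2, is_svd (A m) t.1.1 t.1.2 t.2.
  by have [u [a [v h]]] := svd_SL2 (A m); exists (u, a, v).
have [f [U [V [e [cf fh]]]]] := svd_seq_extract hF.
by exists f; do 3 eexists; exists U, V, e; split; [|exact: fh].
Qed.

Lemma subgroup1 G : subgroup G -> G 1%g. Proof. by case. Qed.

Lemma subgroupV G x : subgroup G -> G x -> G x^-1%g.
Proof. by case=> G1 GV Gx; rewrite -[x^-1%g]mul1g; exact: GV. Qed.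

Lemma subgroupM G x y : subgroup G -> G x -> G y -> G (x * y)%g.
Proof.
move=> sG Gx Gy; rewrite -[y]invgK; case: (sG) => _; apply=> //; exact: subgroupV.
Qed.

Lemma psl_piVE (A : SL R 2) : (\pi_(PSL R 2) A)^-1%g = \pi_(PSL R 2) A^-1%g.
Proof. exact: psl_piV. Qed.

(* If the singular values stay bounded, the sequence converges in SL(2,C), so
   that the quotients of its terms tend to the identity. *)
Lemma discrete_svd_seq G A f u a v U V e : discrete_subgroup G ->
  (forall m, G (\pi_(PSL R 2) (A m))) ->
  injective (fun m => \pi_(PSL R 2) (A m)) -> cofinal_seq f ->
  svd_seq (A \o f) u a v U V e -> e = 0.
Proof.
move=> [sG dG] GA injA cf sv; apply/eqP/negPn/negP => e0.
pose B := slval U *m diag2 e^-1 e *m slval V.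
have AB : mcvg (fun m => slval (A (f m))) B.
  apply: (@mcvg_ext _ _ _ (fun m => slval (u m) *m
      diag2 (slval (a m) 1 1)^-1 (slval (a m) 1 1) *m slval (v m))).
    move=> m; have [/= -> _ _ da /andP[a0 _]] := svds_svd sv m.
    rewrite !slM [in RHS](sl_diagE da); congr (_ *m diag2 _ _ *m _).
    by apply: (mulIf (lt0r_neq0 a0)); rewrite mulVf ?lt0r_neq0 // sl_diag_det.
  apply: mcvgM (svds_v sv); apply: mcvgM (svds_u sv) _.
  have se := svds_e sv.
  apply: ord2_cases; apply: ord2_cases; rewrite diag2E.
  - rewrite (_ : (fun k => _) = fun k => (slval (a k) 1 1)^-1); first exact: ncvgV.
    by apply/funext => k; rewrite diag2E.
  - rewrite (_ : (fun k => _) = fun k => 0); first exact: ncvg_cst.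
    by apply/funext => k; rewrite diag2E.
  - rewrite (_ : (fun k => _) = fun k => 0); first exact: ncvg_cst.
    by apply/funext => k; rewrite diag2E.
  - rewrite (_ : (fun k => _) = fun k => slval (a k) 1 1) //.
    by apply/funext => k; rewrite diag2E.
have [_ [W W1 WG]] := dG _ (subgroup1 sG).
have /nbhs_set_val[W' /nbhs_mxP[eps eps0 hW'] hW] :
  nbhs (1%g : SL R 2) (\pi_(PSL R 2) @^-1` W).
  exact: (@pi_continuous _ {eq_quot (@sl_equiv R 2)} (1%g : SL R 2) W W1).
have Q1 : mcvg (fun m => slval (A (f m)) *m \adj (slval (A (f m.+1)))) 1%:M.
  have <- : B *m \adj B = 1%:M by rewrite mul_mx_adj (det_lim AB).
  apply: mcvgM => //; apply: mcvg_adj22.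
  by apply: (@cofinal_mcvg _ _ _ succn _ _ _ AB) => m; exact: leqnSn.
have [N hN] := mcvg_near eps0 Q1.
(* The quotient of consecutive terms lies in a neighbourhood isolating 1 in G, so it is 1, and
   injectivity makes f eventually constant. This contradicts cofinality. *)
have fS m : (N <= m)%N -> f m = f m.+1.
  move=> Nm; apply: injA; apply: (mulIg (\pi_(PSL R 2) (A (f m.+1)))^-1%g).
  rewrite mulgV.
  have : (W `&` G) (\pi_(PSL R 2) (A (f m)) * (\pi_(PSL R 2) (A (f m.+1)))^-1)%g.
    split; last by apply: subgroupM => //; exact: subgroupV.
    rewrite psl_piVE psl_mulE; apply: hW; apply: hW' => i j.
    by have := hN m Nm i j; rewrite -sl_adj.
  by rewrite WG.
have fN k : f (N + k)%N = f N.
  by elim: k => [|k <-]; rewrite ?addn0 // addnS -fS // leq_addr.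
by have := cf (N + (f N).+1)%N; rewrite fN; lia.
Qed.

End SingularSequences.
(** * Limits of divergent sequences *)

Section LimitMatrices.
Variable R : realType.
Local Notation C := R[i].
Implicit Types (G : set (PSL R 2)) (A u a v : nat -> SL R 2).

(* The quasi-projective limits of divergent sequences of G, as matrices. *)
Definition limit_mx G (M : 'M[C]_2) : Prop :=
  M != 0 /\ exists A (c : nat -> C),
    [/\ forall m, G (\pi_(PSL R 2) (A m)), ncvg c 0 &
        mcvg (fun m => c m *: slval (A m)) M].

Lemma limit_mx_mull G (g : SL R 2) M : subgroup G -> G (\pi_(PSL R 2) g) ->
  limit_mx G M -> limit_mx G (slval g *m M).
Proof.
move=> sG Gg [M0 [A [c [GA c0 AM]]]]; split.
  by apply: contra_neq M0 => gM; rewrite -(mulKmx (sl_unit g) M) gM mulmx0.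
exists (fun m => g * A m)%g, c; split=> // [m|].
  by rewrite -psl_mulE; exact: subgroupM.
apply: mcvg_ext (mcvgM (mcvg_cst (slval g)) AM) => m.
by rewrite -scalemxAr.
Qed.

Lemma limit_mx_mulr G (g : SL R 2) M : subgroup G -> G (\pi_(PSL R 2) g) ->
  limit_mx G M -> limit_mx G (M *m slval g).
Proof.
move=> sG Gg [M0 [A [c [GA c0 AM]]]]; split.
  by apply: contra_neq M0 => gM; rewrite -(mulmxK (sl_unit g) M) gM mul0mx.
exists (fun m => A m * g)%g, c; split=> // [m|].
  by rewrite -psl_mulE; exact: subgroupM.
apply: mcvg_ext (mcvgM AM (mcvg_cst (slval g))) => m.
by rewrite -scalemxAl.
Qed.

Lemma limit_mx_adj G M : subgroup G -> limit_mx G M -> limit_mx G (\adj M).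
Proof.
move=> sG [M0 [A [c [GA c0 AM]]]]; split.
  by apply: contra_neq M0 => aM; rewrite -(adj22K M) aM; apply: mx22P; rewrite adj22 !mxE ?oppr0.
exists (fun m => (A m)^-1)%g, c; split=> // [m|].
  by rewrite -psl_piVE; exact: subgroupV.
by apply: mcvg_ext (mcvg_adj22 AM) => m; rewrite adj22Z sl_adj.
Qed.

Lemma limit_mx_mul G M N : subgroup G -> limit_mx G M -> limit_mx G N ->
  M *m N != 0 -> limit_mx G (M *m N).
Proof.
move=> sG [M0 [A [c [GA c0 AM]]]] [N0 [B [d [GB d0 BN]]]] MN; split=> //.
exists (fun m => A m * B m)%g, (fun m => c m * d m); split=> [m||].
- by rewrite -psl_mulE; exact: subgroupM.
- by rewrite -[0](mulr0 0); exact: ncvgM.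
by apply: mcvg_ext (mcvgM AM BN) => m; rewrite -scalemxAl -scalemxAr scalerA.
Qed.

Lemma limit_mxZ G k M : k != 0 -> limit_mx G M -> limit_mx G (k *: M).
Proof.
move=> k0 [M0 [A [c [GA c0 AM]]]]; split; first by rewrite scaler_eq0 negb_or k0.
exists A, (fun m => k * c m); split=> //.
  by rewrite -[0](mulr0 k); apply: ncvgM c0; exact: ncvg_cst.
by apply: mcvg_ext (mcvgZ (ncvg_cst k) AM) => m; rewrite scalerA.
Qed.

(** The singular values have product 1, so multiplying by the smaller one, d, turns the diagonal
    part into diag(1, d^2). *)
Lemma svd_seq_scaled A u a v U V e : svd_seq A u a v U V e ->
  mcvg (fun m => slval (a m) 1 1 *: slval (A m))
       (slval U *m diag2 1 (e ^+ 2) *m slval V).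
Proof.
move=> sv; apply: (@mcvg_ext _ _ _ (fun m => slval (u m) *m
    diag2 1 (slval (a m) 1 1 ^+ 2) *m slval (v m))).
  move=> m; have [/= -> _ _ da _] := svds_svd sv m.
  rewrite !slM [in RHS](sl_diagE da) scalemxAl scalemxAr; congr (_ *m _ *m _).
  by apply: mx22P; rewrite [RHS]mxE !diag2E ?mulr0 // 1?mulrC ?sl_diag_det // expr2.
apply: mcvgM (svds_v sv); apply: mcvgM (svds_u sv) _.
apply: ord2_cases; apply: ord2_cases; rewrite diag2E.
- by rewrite (_ : (fun k => _) = fun=> 1); [exact: ncvg_cst | apply/funext => k; rewrite diag2E].
- by rewrite (_ : (fun k => _) = fun=> 0); [exact: ncvg_cst | apply/funext => k; rewrite diag2E].
- by rewrite (_ : (fun k => _) = fun=> 0); [exact: ncvg_cst | apply/funext => k; rewrite diag2E].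
rewrite (_ : (fun k => _) = fun k => slval (a k) 1 1 ^+ 2).
  exact: ncvgX (svds_e sv).
by apply/funext => k; rewrite diag2E.
Qed.

Lemma diag2_10_neq0 (U V : SL R 2) : slval U *m diag2 1 0 *m slval V != 0.
Proof.
apply/eqP => UV; have : diag2 1 0 = 0 :> 'M[C]_2.
  rewrite -(mulKmx (sl_unit U) (diag2 1 0)) -(mulmxK (sl_unit V) (slval U *m _)).
  by rewrite UV mul0mx mulmx0.
by move/matrixP/(_ 0 0); rewrite diag2E mxE => /eqP; rewrite oner_eq0.
Qed.

Lemma limit_mx_svd G A u a v U V : svd_seq A u a v U V 0 ->
  (forall m, G (\pi_(PSL R 2) (A m))) -> limit_mx G (slval U *m diag2 1 0 *m slval V).
Proof.
move=> sv GA; split; first exact: diag2_10_neq0.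
exists A, (fun m => slval (a m) 1 1); split=> //; first exact: (svds_e sv).
by have := svd_seq_scaled sv; rewrite expr0n.
Qed.

(** Each new index is chosen beyond every occurrence of the value just taken, so no value recurs. *)
Lemma injective_extract (T : Type) (s : nat -> T) :
  (forall x, exists N, forall k, (N <= k)%N -> s k <> x) ->
  exists f, cofinal_seq f /\ injective (s \o f).
Proof.
move=> h; have /choice[N hN] k := h (s k).
pose f := fix f m := if m is m'.+1 then maxn (f m').+1 (N (f m')) else 0%N.
have f_mono m d : (f m <= f (m + d))%N.
  elim: d => [|d ih]; rewrite ?addn0 // addnS (leq_trans ih) //= leq_max.
  by rewrite ltnW.
have f_lt m n : (m < n)%N -> s (f n) <> s (f m).
  move=> mn; apply: hN; rewrite -(subnKC mn) (leq_trans _ (f_mono _ _)) //=.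
  exact: leq_maxr.
exists f; split=> [|m n /= fmn].
  by elim=> // m ih /=; rewrite leq_max ltnS ih.
by case: (ltngtP m n) => // /f_lt; rewrite fmn.
Qed.

(** Lifts of one x to determinant 1 differ by scalars of norm 1, so they stay bounded and rescaling
    by c -> 0 would give the limit 0. *)
Lemma limit_mx_finite_mult G (A : nat -> SL R 2) (c : nat -> C) M (x : PSL R 2) :
  M != 0 -> ncvg c 0 -> mcvg (fun m => c m *: slval (A m)) M ->
  exists N, forall k, (N <= k)%N -> \pi_(PSL R 2) (A k) <> x.
Proof.
move=> M0 c0 AM; apply: contrapT => h.
have h' (k N : nat) : exists m (t : unit), (N <= m)%N /\ \pi_(PSL R 2) (A m) = x.
  apply: contrapT => h'; apply: h; exists N => m Nm Am; apply: h'.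
  by exists m, tt.
have [f [_ [cf hf]]] := cofinal_extract (P := fun _ m _ => \pi_(PSL R 2) (A m) = x) h'.
case/eqP: M0; apply: mcvg_unique (cofinal_mcvg cf AM) _.
rewrite -(scaler0 _ (0 : C)) => i j; rewrite !mxE mulr0.
have /choice[d hd] k : exists d, slval (A (f k)) = d *: slval (repr x).
  have [|d _ e] := (psl_eqP (repr x) (A (f k))).2; first by rewrite reprK hf.
  by exists d.
have nd k : `|d k| = 1.
  have : \det (slval (A (f k))) = 1 := slP _.
  rewrite hd detZ slP mulr1 => /(congr1 Num.norm); rewrite normrX normr1.
  by move/eqP; rewrite pexpr_eq1 // => /eqP.
apply: (@ncvg0_norm _ (fun k => c (f k) * slval (repr x) i j)).
  by move=> k; rewrite /= mxE hd mxE !normrM nd mul1r.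
rewrite -(mul0r (slval (repr x) i j)); apply: ncvgM (ncvg_cst _).
exact: (cofinal_ncvg cf c0).
Qed.

(* [slval U *m diag2 1 0 *m slval V] is the rank one matrix whose image is
   spanned by the first column of U, and whose kernel is annihilated by the
   first row of V. *)
Lemma limit_mx_svd_seq G M : limit_mx G M -> exists A u a v U V k,
  [/\ forall m, G (\pi_(PSL R 2) (A m)),
      injective (fun m => \pi_(PSL R 2) (A m)), svd_seq A u a v U V 0,
      forall m, slval (a m) 1 1 < slval (a m) 0 0 &
      k != 0 /\ M = k *: (slval U *m diag2 1 0 *m slval V)].
Proof.
move=> [M0 [A [c [GA c0 AM]]]].
have [f [u [a [v [U [V [e [cf sv]]]]]]]] := svd_extract A.
have A'M := cofinal_mcvg cf AM; have c'0 := cofinal_ncvg cf c0.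
(* Stripping the unitary factors leaves rescaled diagonal matrices. Their limit is diagonal, and its
   lower entry vanishes because the smaller singular value is at most 1. *)
pose D m := c (f m) *: slval (a m).
have DM : mcvg D (\adj (slval U) *m M *m \adj (slval V)).
  apply: mcvg_ext (mcvgM (mcvgM (mcvg_adj22 (svds_u sv)) A'M)
    (mcvg_adj22 (svds_v sv))) => m /=.
  have [/= -> _ _ da _] := svds_svd sv m.
  rewrite !slM -scalemxAr -scalemxAl /D; congr (_ *: _).
  rewrite -!sl_adj -!slM; congr slval.
  by rewrite !mulgA mulVg mul1g mulgK.
set M' := \adj (slval U) *m M *m \adj (slval V) in DM.
have MM' : M = slval U *m M' *m slval V.
  rewrite /M' -!sl_adj !mulmxA -slM mulgV mul1mx -mulmxA -slM mulVg mulmx1 //.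
have D10 i j : i != j -> M' i j = 0.
  move=> ij; apply: ncvg_unique (DM i j) _.
  rewrite (_ : (fun k => _) = fun=> 0); first exact: ncvg_cst.
  apply/funext => m; have [_ _ _ /is_diag_mxP da _] := svds_svd sv m.
  by rewrite mxE da ?mulr0.
have M'11 : M' 1 1 = 0.
  apply: ncvg_unique (DM 1 1) _; apply: ncvg0_norm c'0 => m.
  have [_ _ _ da /andP[a0 a1]] := svds_svd sv m.
  rewrite mxE normrM ler_piMr // gtr0_norm // sl_diag_le1 // a0 //.
pose k := M' 0 0.
have M'E : M' = k *: diag2 1 0.
  apply: mx22P; rewrite [RHS]mxE !diag2E ?mulr1 ?mulr0 //; exact: D10.
have k0 : k != 0.
  by apply: contra_neq M0 => k0; rewrite MM' M'E k0 scale0r mulmx0 mul0mx.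
(* The upper entry of [D m] times the smaller singular value is [c (f m)], which tends to 0. *)
have ke : k * e = 0.
  apply: ncvg_unique (ncvgM (DM 0 0) (svds_e sv)) _.
  rewrite (_ : (fun m => _) = c \o f) // ; apply/funext => m.
  have [_ _ _ da _] := svds_svd sv m.
  by rewrite mxE -mulrA sl_diag_det // mulr1.
have {ke}e0 : e = 0 by move/eqP: ke; rewrite mulf_eq0 (negPf k0) => /eqP.
subst e.
have [N hN] : exists N, forall m, (N <= m)%N -> slval (a m) 1 1 < slval (a m) 0 0.
  have [N hN] := svds_e sv ltr01; exists N => m /hN; rewrite sub0r normrN.
  have [_ _ _ da /andP[a0 a1]] := svds_svd sv m; rewrite gtr0_norm // => alt1.
  rewrite lt_neqAle a1 andbT; apply/eqP => ea; have := sl_diag_det da.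
  rewrite -ea => aa; have := mulr_ilt1 (ltW a0) (ltW a0) alt1 alt1.
  by rewrite aa ltxx.
have cN := cofinal_addn N; have cfN := cofinal_comp cf cN.
have [g [cg ig]] := injective_extract (fun x => limit_mx_finite_mult G x M0
  (cofinal_ncvg cfN c0) (cofinal_mcvg cfN AM)).
have cNg := cofinal_comp cN cg.
exists (A \o (f \o (addn N \o g))), (u \o (addn N \o g)), (a \o (addn N \o g)),
  (v \o (addn N \o g)), U, V, k; split.
- by move=> m; exact: GA.
- exact: ig.
- exact: (svd_seq_cofinal cNg sv).
- by move=> m; apply: hN; exact: leq_addr.
- by split=> //; rewrite {1}MM' M'E -scalemxAr -scalemxAl.
Qed.

End LimitMatrices.

(** * Consequences of irreducibility *)

Section Irreducibility.
Variable R : realType.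
Local Notation C := R[i].

(** Otherwise the orbit of x stays in the kernel of r, which is the line through x, and this line
    would be G-invariant. The lemma serves to move an attracting point off a repelling one. *)
Lemma strongly_irreducible_pairing (G : set (PSL R 2)) (r : 'rV[C]_2) (x : 'cV[C]_2) :
  subgroup G -> strongly_irreducible G -> r != 0 -> x != 0 ->
  exists2 h : SL R 2, G (\pi_(PSL R 2) h) & r *m slval h *m x != 0.
Proof.
move=> sG irr r0 x0; apply: contrapT => h.
have hr (g : SL R 2) : G (\pi_(PSL R 2) g) -> r *m slval g *m x = 0.
  by move=> Gg; apply/eqP/negPn/negP => gx; apply: h; exists g.
have colx (y : 'cV[C]_2) : r *m y = 0 -> exists c, y = c *: x.
  have rx : r *m x = 0.
    by have := hr 1%g (subgroup1 sG : G (\pi_(PSL R 2) 1%g)); rewrite mulmx1.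
  move=> ry.
  have rE (z : 'cV[C]_2) : r *m z = 0 -> r 0 0 * z 0 0 + r 0 1 * z 1 0 = 0.
    by move=> /matrixP/(_ 0 0); rewrite mulmx2E mxE.
  have {ry}ry := rE _ ry; have {rx}rx := rE _ rx.
  (* Two vectors killed by a nonzero r in dimension 2 are proportional. *)
  have D : x 0 0 * y 1 0 = x 1 0 * y 0 0.
    have [r00|r00] := eqVneq (r 0 0) 0.
      have r01 : r 0 1 != 0.
        apply: contra_neq r0 => r01; apply/rowP; apply: ord2_cases; by rewrite mxE.
      move: rx ry; rewrite r00 !mul0r !add0r => /eqP; rewrite mulf_eq0 (negPf r01) /=.
      move=> /eqP-> /eqP; rewrite mulf_eq0 (negPf r01) /= => /eqP->.
      by rewrite mulr0 mul0r.
    apply: (mulfI r00); rewrite !mulrA.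
    have -> : r 0 0 * x 0 0 = - (r 0 1 * x 1 0) by apply/eqP; rewrite -addr_eq0 rx.
    rewrite [RHS]mulrAC.
    have -> : r 0 0 * y 0 0 = - (r 0 1 * y 1 0) by apply/eqP; rewrite -addr_eq0 ry.
    by rewrite !mulNr mulrAC.
  have [x00|x00] := eqVneq (x 0 0) 0.
    have x10 : x 1 0 != 0.
      apply: contra_neq x0 => x10; apply/colP; apply: ord2_cases; by rewrite mxE.
    exists (y 1 0 / x 1 0); apply/colP; apply: ord2_cases; rewrite mxE ?divfK // x00 mulr0.
    by move/eqP: D; rewrite x00 mul0r eq_sym mulf_eq0 (negPf x10) /= => /eqP.
  exists (y 0 0 / x 0 0); apply/colP; apply: ord2_cases; rewrite mxE ?divfK //.
  by apply: (mulfI x00); rewrite D; field.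
have fi : finite_index_subgroup G G.
  split=> //; apply: sub_finite_set (finite_set1 G) => _ [g Gg <-].
  apply/seteqP; split=> [_ [k Gk <-]|k Gk]; first exact: subgroupM.
  exists (g^-1 * k)%g; last by rewrite mulgA mulgV mul1g.
  by apply: subgroupM => //; exact: subgroupV.
have [] := irr G <[x]>%VS fi.
- move=> g Gg _ /vlineP[c ->]; have [|d gx] := colx (slval (repr g) *m x).
    by rewrite mulmxA; apply: hr; rewrite reprK.
  by rewrite -scalemxAr gx scalerA; apply/vlineP; exists (c * d).
- by move=> x0'; have := memv_line x; rewrite x0' memv0 (negPf x0).
- by move=> xT; have := dim_vline x; rewrite xT x0 dimvf /dim /=.
Qed.

End Irreducibility.
(** * Osculating subspaces of the Veronese curve *)

Section VeroneseContinuity.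
Variables (K : numFieldType) (n : nat).

Definition pcvg (P : nat -> {poly K}) (Q : {poly K}) : Prop :=
  forall i, ncvg (fun m => (P m)`_i) Q`_i.

Lemma pcvgM P Q P' Q' : pcvg P P' -> pcvg Q Q' ->
  pcvg (fun m => P m * Q m) (P' * Q').
Proof.
move=> PP QQ i; rewrite coefM.
rewrite (_ : (fun m => _) = fun m => \sum_(j < i.+1) (P m)`_j * (Q m)`_(i - j)).
  by apply: ncvg_sum => j; exact: ncvgM.
by apply/funext => m; rewrite coefM.
Qed.

Lemma pcvgX P P' k : pcvg P P' -> pcvg (fun m => P m ^+ k) (P' ^+ k).
Proof.
move=> PP; elim: k => [|k ih] i; first exact: ncvg_cst.
have := pcvgM PP ih i; rewrite exprS; congr ncvg.
by apply/funext => m; rewrite exprS.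
Qed.

Lemma pcvg_lin (a b : nat -> K) a' b' : ncvg a a' -> ncvg b b' ->
  pcvg (fun m => (a m)%:P + b m *: 'X) (a'%:P + b' *: 'X).
Proof.
move=> aa bb i; rewrite coefD coefC coefZ coefX.
rewrite (_ : (fun m => _) = fun m => (if i == 0%N then a m else 0) + b m * (i == 1%N)%:R).
  apply: ncvgD; last by apply: ncvgM => //; exact: ncvg_cst.
  by case: eqP => _ //; exact: ncvg_cst.
by apply/funext => m; rewrite coefD coefC coefZ coefX.
Qed.

Lemma mcvg_veronese (X : nat -> 'M[K]_2) A : mcvg X A ->
  mcvg (fun m => veronese_mx n (X m)) (veronese_mx n A).
Proof.
move=> XA i j; rewrite mxE.
rewrite (_ : (fun m => _) = fun m => (((X m 0 0)%:P + X m 1 0 *: 'X) ^+ (n - j) *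
     ((X m 0 1)%:P + X m 1 1 *: 'X) ^+ j)`_i).
  by apply: pcvgM; apply: pcvgX; apply: pcvg_lin; exact: XA.
by apply/funext => m; rewrite mxE.
Qed.

Lemma veronese_diag2 (a b : K) i j :
  veronese_mx n (diag2 a b) i j = if i == j then a ^+ (n - i) * b ^+ i else 0.
Proof.
rewrite mxE !diag2E scale0r addr0 add0r -polyC_exp mul_polyC coefZ exprZn coefZ coefXn.
by rewrite -val_eqE eq_sym /=; case: eqP => [<-|_]; rewrite ?mulr1 // !mulr0.
Qed.

Lemma veronese_mx1 : veronese_mx n 1%:M = 1%:M :> 'M[K]_n.+1.
Proof.
apply/matrixP => i j; rewrite -diag2_1 veronese_diag2 !expr1n mulr1 mxE.
by case: eqP.
Qed.

Lemma veronese_flip (X : 'cV[K]_n.+1) i :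
  (veronese_mx n (flip_mx K) *m X) i 0 = (-1) ^+ i * X (rev_ord i) 0.
Proof.
rewrite mxE (bigD1 (rev_ord i)) //= big1 ?addr0 => [|j ji]; rewrite mxE !flip_mxE.
  rewrite polyC1 polyC0 add0r scale0r addr0 expr1n mulr1 exprZn coefZ coefXn /=.
  by rewrite subKn ?eqxx ?mulr1 // -ltnS.
rewrite polyC1 polyC0 add0r scale0r addr0 expr1n mulr1 exprZn coefZ coefXn.
case: eqP => [e|_]; last by rewrite mulr0 mul0r.
case/eqP: ji; apply: val_inj; rewrite /= e; have := ltn_ord j; lia.
Qed.

Lemma veronese_upper (T : 'M[K]_2) (i j : 'I_n.+1) : T 1 0 = 0 -> (j < i)%N ->
  veronese_mx n T i j = 0.
Proof.
move=> T0 ji; rewrite mxE T0 scale0r addr0 -polyC_exp mul_polyC coefZ.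
by rewrite coef_lin_gt ?mulr0.
Qed.

(** Products of rank one limits collapse through this identity: p r^T X p' r'^T is the scalar r^T X
    p' times p r'^T. *)
Lemma diag2_10_mul (X : 'M[K]_2) :
  diag2 1 0 *m X *m diag2 1 0 = X 0 0 *: diag2 1 0.
Proof. by apply: mx22P; rewrite [RHS]mxE !mulmx2E !diag2E; ring. Qed.

End VeroneseContinuity.

Section Osculating.
Variables (R : realType) (n : nat).
Local Notation C := R[i].
Local Notation V A := (veronese_mx n (slval A)).
Implicit Types (A B U : SL R 2) (X Y : 'cV[C]_n.+1).

Lemma veronese_slM A B : V (A * B)%g = V A *m V B.
Proof. by rewrite -veronese_mxM. Qed.

Lemma veronese_slV A : V A^-1%g *m V A = 1%:M.
Proof. by rewrite -veronese_slM mulVg veronese_mx1. Qed.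

Lemma veronese_slVr A : V A *m V A^-1%g = 1%:M.
Proof. by rewrite -veronese_slM mulgV veronese_mx1. Qed.

Lemma veronese_mul_neq0 A X : X != 0 -> V A *m X != 0.
Proof.
apply: contra_neq => AX.
by rewrite -[X]mul1mx -(veronese_slV A) -mulmxA AX mulmx0.
Qed.

Lemma psl_act_pclass k (B : SL R k.+1) (X : 'cV[C]_k.+1) : X != 0 ->
  psl_act (\pi_(PSL R k.+1) B) (pclass X) = pclass (slval B *m X).
Proof.
move=> X0; rewrite /psl_act; have [c c0 ->] := psl_repr B; have [d d0 ->] := pclassK X0.
apply/esym/(@pclass_eq _ _ _ _ _ (c * d)); first by rewrite mulf_neq0.
by rewrite -scalemxAl -scalemxAr scalerA.
Qed.

Lemma rho_act A X : X != 0 ->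
  psl_act (rho n (\pi_(PSL R 2) A)) (pclass X) = pclass (V A *m X).
Proof. by move=> X0; rewrite rho_pi psl_act_pclass. Qed.

Lemma psl_qp_rho A : psl_qp (rho n (\pi_(PSL R 2) A)) = pclass (V A).
Proof.
rewrite rho_pi /psl_qp; have [c c0 e] := psl_repr (rho_sl n A).
exact/esym/(pclass_eq c0 e).
Qed.

(** Membership in [F_plus j A], read on vectors. For 1 <= j <= n these are the binary forms
    divisible by the (n-j+1)-st power of the linear form A e_1, that is, the osculating subspace of
    the Veronese curve at psi [A e_1]. *)
Definition osculating j A X : Prop :=
  forall i : 'I_n.+1, (j <= i)%N -> (V A^-1%g *m X) i 0 = 0.

Lemma F_plusP j A X : X != 0 -> F_plus j A (pclass X) <-> osculating j A X.
Proof.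
move=> X0; split=> [[z zj]|AX].
  rewrite -[z in psl_act _ z]pclass_prepr rho_act ?prepr_neq0 // => e.
  have [c c0 cE] := pclassK X0.
  have [d d0 dE] := pclassK (veronese_mul_neq0 A (prepr_neq0 z)).
  move=> i ji; have XE : X = (c^-1 * d) *: (V A *m prepr z).
    by rewrite -scalerA -dE e cE scalerA mulVf ?scale1r.
  by rewrite XE -scalemxAr mulmxA veronese_slV mul1mx mxE zj // mulr0.
exists (pclass (V A^-1%g *m X)).
  move=> i ji; have [c c0 ->] := pclassK (veronese_mul_neq0 A^-1%g X0).
  by rewrite mxE AX // mulr0.
by rewrite rho_act ?veronese_mul_neq0 // mulmxA veronese_slVr mul1mx.
Qed.

Lemma osculating_mull j B A X : osculating j A X -> osculating j (B * A)%g (V B *m X).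
Proof.
move=> AX i /AX; rewrite mulmxA invgM veronese_slM -(mulmxA (V A^-1%g)).
by rewrite veronese_slV mulmx1.
Qed.

(** An upper triangular T preserves the flag of coordinate subspaces, so the osculating subspace
    depends only on the point [A e_1]. *)
Lemma osculating_mulr j A (T : SL R 2) X : slval T 1 0 = 0 ->
  osculating j A X -> osculating j (A * T)%g X.
Proof.
move=> T0 AX i ji; rewrite invgM veronese_slM -mulmxA mxE big1 // => l _.
have [il|li] := leqP i l; first by rewrite AX ?mulr0 // (leq_trans ji).
by rewrite veronese_upper ?mul0r // sl_adj adj22 T0 oppr0.
Qed.

(** Proportional rank one matrices have the same image, so U and U' have proportional first columns
    and differ by a triangular factor. This makes the subspace independent of the decomposition
    chosen. *)
Lemma osculating_limit j U U' (W W' : SL R 2) c X :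
  slval U *m diag2 1 0 *m slval W = c *: (slval U' *m diag2 1 0 *m slval W') ->
  osculating j U X -> osculating j U' X.
Proof.
move=> UU AX; have -> : U' = (U * (U^-1 * U'))%g by rewrite mulgA mulgV mul1g.
apply: osculating_mulr AX.
pose T := (U'^-1 * U)%g; pose S := (W * W'^-1)%g.
have -> : (U^-1 * U')%g = (T^-1)%g by rewrite /T invgM invgK.
suff T10 : slval T 1 0 = 0 by rewrite sl_adj adj22 T10 oppr0.
have : slval T *m diag2 1 0 *m slval S = c *: diag2 1 0.
  have -> : slval T *m diag2 1 0 *m slval S =
    slval U'^-1%g *m (slval U *m diag2 1 0 *m slval W) *m slval W'^-1%g.
    by rewrite !slM !mulmxA.
  rewrite UU -scalemxAr -scalemxAl !mulmxA -slM mulVg mul1mx -mulmxA -slM mulgV.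
  by rewrite mulmx1.
(* The lower row of the product is T10 times the first row of S, which is nonzero as S is
   invertible. *)
move=> /matrixP TS; have := TS 1 0; have := TS 1 1.
rewrite [RHS]mxE (mulmx2E _ (slval S)) !(mulmx2E (slval T)) !diag2E.
rewrite !mulr0 !mulr1 !addr0 !mul0r addr0 => /eqP; rewrite mulf_eq0 => /orP[/eqP//|/eqP S01].
rewrite [RHS]mxE (mulmx2E _ (slval S)) !(mulmx2E (slval T)) !diag2E.
rewrite !mulr0 !mulr1 !addr0 !mul0r addr0 => /eqP; rewrite mulf_eq0 => /orP[/eqP//|/eqP S00].
by have := slP S; rewrite det22 S00 S01 !mul0r subr0 => /esym/eqP; rewrite oner_eq0.
Qed.

End Osculating.
(** * Loxodromic sequences *)

Section LoxodromicSequences.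
Variables (R : realType) (n : nat).
Hypothesis n_gt0 : (0 < n)%N.
Local Notation C := R[i].
Local Notation V A := (veronese_mx n (slval A)).
Local Notation e1 := (delta_mx 0 0 : 'cV[C]_2).

Lemma veronese_vec_e1 : veronese_vec n e1 = delta_mx 0 0.
Proof.
apply/colP => i; rewrite !mxE /= !andbT expr1n mulr1 expr0n -val_eqE /=.
by case: (val i) => [|k]; rewrite ?bin0 ?mulr1 // mulr0.
Qed.

(** [veronese_mx] is defined on singular matrices too and sends rank one to rank one; this describes
    the quasi-projective limit, with image psi of the attracting point. *)
Lemma veronese_limit_mul (U W : SL R 2) (z : 'cV[C]_n.+1) :
  veronese_mx n (slval U *m diag2 1 0 *m slval W) *m z =
  (V W *m z) 0 0 *: veronese_vec n (slval U *m e1).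
Proof.
rewrite !veronese_mxM -!mulmxA -veronese_mx_vec veronese_vec_e1 scalemxAr.
congr (_ *m _); apply/colP => i; rewrite [RHS]mxE mxE (bigD1 0) //= big1 => [|j j0].
  rewrite veronese_diag2 expr1n mul1r addr0 [delta_mx _ _ _ _]mxE eqxx andbT mulrC.
  by case: eqP => [->|_]; rewrite ?expr0 // mulr0 mul0r.
rewrite veronese_diag2; case: eqP => [->|_]; rewrite ?mul0r //.
by rewrite expr0n -[_ == _]/(j == 0) (negPf j0) mulr0 mul0r.
Qed.

Lemma slval_mul_neq0 (U : SL R 2) (x : 'cV[C]_2) : x != 0 -> slval U *m x != 0.
Proof. by apply: contra_neq => Ux; rewrite -(mulKmx (sl_unit U) x) Ux mulmx0. Qed.

Lemma e1_neq0 : e1 != 0.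
Proof. by apply/eqP => /matrixP/(_ 0 0); rewrite !mxE; apply/eqP; rewrite oner_eq0. Qed.

Lemma mulmx_e1 (X : 'M[C]_2) i : (X *m e1) i 0 = X i 0.
Proof. by rewrite mulmx2E !mxE /= mulr1 mulr0 addr0. Qed.

Lemma psi_pclass (x : 'cV[C]_2) : x != 0 -> psi n (pclass x) = pclass (veronese_vec n x).
Proof.
move=> x0; rewrite /psi; have [c c0 ->] := pclassK x0; rewrite veronese_vecZ.
by apply/esym/(@pclass_eq _ _ _ _ _ (c ^+ n)); rewrite ?expf_neq0.
Qed.

Lemma hyp_orbit1 G (A : SL R 2) : G (\pi_(PSL R 2) A) ->
  hyp_orbit G 1%:M (pclass (slval A *m (slval A)^t*)).
Proof.
move=> GA; exists (\pi_(PSL R 2) A); first exact: GA.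
rewrite mulmx1.
have [c c0 ->] := psl_repr A.
apply/esym/(@pclass_eq _ _ _ _ _ (c * c^*)); first by rewrite mulf_neq0 ?conjC_eq0.
by rewrite trmxC_gramZ.
Qed.

Lemma closure_seq m k (S : set (PM R m k)) (X : nat -> 'M[C]_(m.+1, k.+1)) A :
  A != 0 -> mcvg X A -> (forall i, S (pclass (X i))) -> closure S (pclass A).
Proof.
move=> A0 XA SX B /(pclass_cvg A0 XA)[N _ hN].
by exists (pclass (X N)); split; [exact: SX | exact: (hN N (leqnn N))].
Qed.

Lemma posdef1 : posdef_mx (1%:M : 'M[C]_2).
Proof.
split=> [|v v0]; first by rewrite trmx1 map_mx1.
rewrite mulmx1 mulmx2E !mxE ![_^* * _]mulrC -!normCK.
rewrite lt_def addr_ge0 ?exprn_ge0 // andbT; apply: contra_neq v0 => /eqP.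
rewrite paddr_eq0 ?exprn_ge0 // !expf_eq0 /= !normr_eq0 => /andP[/eqP v0 /eqP v1].
by apply/colP; apply: ord2_cases; rewrite mxE.
Qed.

(** The orbit of the identity matrix, a point of H^3, suffices: the rescaled A A^* converge to M
    M^*, a positive multiple of x x^* for x = U e_1. *)
Lemma limit_set_svd G A (c : nat -> C) (U W : SL R 2) :
  (forall m, G (\pi_(PSL R 2) (A m))) -> (forall m, c m != 0) ->
  mcvg (fun m => c m *: slval (A m)) (slval U *m diag2 1 0 *m slval W) ->
  limit_set G (pclass (slval U *m e1)).
Proof.
move=> GA c0; set M := _ *m _ *m _ => AM; exists 1%:M; first exact: posdef1.
(* The squared norm of the first row of W, nonzero because W is invertible. *)
pose k := slval W 0 0 * (slval W 0 0)^* + slval W 0 1 * (slval W 0 1)^*.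
have k0 : k != 0.
  rewrite /k -!normCK paddr_eq0 ?exprn_ge0 // !expf_eq0 /= !normr_eq0.
  apply/negP => /andP[/eqP w0 /eqP w1]; have := slP W.
  by rewrite det22 w0 w1 !mul0r subr0 => /esym/eqP; rewrite oner_eq0.
pose x := slval U *m e1; have x0 : x != 0 := slval_mul_neq0 U e1_neq0.
have MM : M *m M^t* = k *: (x *m x^t*).
  rewrite /M (trmxC_mul (slval U *m diag2 1 0) (slval W))
    (trmxC_mul (slval U) (diag2 1 0)) diag2_tC rmorph1 rmorph0 !mulmxA.
  have -> : slval U *m diag2 1 0 *m slval W *m (slval W)^t* *m diag2 1 0 *m (slval U)^t* =
    slval U *m (diag2 1 0 *m (slval W *m (slval W)^t*) *m diag2 1 0) *m (slval U)^t*.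
    by rewrite !mulmxA.
  rewrite diag2_10_mul -scalemxAr -scalemxAl; congr (_ *: _).
    by rewrite mulmx2E !mxE.
  rewrite /x trmxC_mul !mulmxA; congr (_ *m _); rewrite -!mulmxA; congr (_ *m _).
  by apply: mx22P; rewrite [RHS]mxE big_ord1 !mxE /= ?rmorph1 ?rmorph0 ?(mulr1, mulr0, mul0r).
have xx0 : x *m x^t* != 0.
  apply/eqP => xx; case/eqP: x0; apply/colP => i; rewrite [RHS]mxE.
  move/matrixP/(_ i i)/eqP: xx; rewrite mxE big_ord1 !mxE -normCK.
  by rewrite expf_eq0 /= normr_eq0 => /eqP.
have -> : boundary_point (pclass x) = pclass (M *m M^t*).
  rewrite /boundary_point; have [d d0 ->] := pclassK x0; rewrite MM.
  apply: (@pclass_eq _ _ _ _ _ (k / (d * d^*))).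
    by rewrite !(mulf_neq0, invr_eq0, conjC_eq0).
  by rewrite trmxC_gramZ scalerA divfK // mulf_neq0 ?conjC_eq0.
apply: (closure_seq (X := fun m => c m *: slval (A m) *m (c m *: slval (A m))^t*)).
- by rewrite MM scaler_eq0 negb_or k0.
- exact: mcvgM AM (mcvg_tr AM).
move=> m; have := hyp_orbit1 (GA m).
have cc : c m * (c m)^* != 0 by rewrite mulf_neq0 ?conjC_eq0.
by rewrite (pclass_eq cc (trmxC_gramZ (c m) (slval (A m)))).
Qed.

(** For M = p r^T the condition on the entry (0, 0) reads r^T p != 0: the attracting point is not
    the repelling one. *)
Lemma loxodromic_svd G A (c : nat -> C) (U W : SL R 2) :
  (forall m, G (\pi_(PSL R 2) (A m))) ->
  injective (fun m => \pi_(PSL R 2) (A m)) -> (forall m, c m != 0) ->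
  mcvg (fun m => c m *: slval (A m)) (slval U *m diag2 1 0 *m slval W) ->
  (slval W *m slval U) 0 0 != 0 ->
  loxodromic_sequence G (pclass (slval U *m e1)) (fun m => \pi_(PSL R 2) (A m))
    (pclass (veronese_mx n (slval U *m diag2 1 0 *m slval W)) : QP R n).
Proof.
move=> GA injA c0; set M := _ *m _ *m _ => AM WU.
pose x := slval U *m e1; have x0 : x != 0 := slval_mul_neq0 U e1_neq0.
have nx0 : veronese_vec n x != 0 := veronese_vec_neq0 n x0.
have VM0 : veronese_mx n M != 0.
  apply: contra_neq nx0 => VM.
  have := veronese_limit_mul U W (V W^-1%g *m veronese_vec n e1).
  rewrite -/M VM mul0mx mulmxA veronese_slVr mul1mx veronese_vec_e1 mxE scale1r.
  by move=> <-.
have [d d0 dE] := pclassK VM0.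
have Mz z : prepr (pclass (veronese_mx n M) : QP R n) *m z =
    (d * (V W *m z) 0 0) *: veronese_vec n x.
  by rewrite dE -scalemxAl veronese_limit_mul scalerA.
split=> //.
- rewrite (_ : (fun m => _) = fun m => pclass (veronese_mx n (c m *: slval (A m))) : QP R n).
    exact: (pclass_cvg VM0 (mcvg_veronese AM)).
  apply/funext => m; rewrite psl_qp_rho veronese_mxZ.
  by apply: (@pclass_eq _ _ _ _ _ (c m ^+ n)); rewrite ?expf_neq0.
- case=> g _; rewrite /psl_qp => e.
  (* W^-1 e_2 spans the kernel of M. Its Veronese vector is killed by the limit, as n > 0, so the
     limit is not the class of an invertible matrix. *)
  pose y := delta_mx 1 0 : 'cV[C]_2.
  have y0 : y != 0.
    by apply/eqP => /matrixP/(_ 1 0); rewrite !mxE; apply/eqP; rewrite oner_eq0.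
  pose z := veronese_vec n (slval W^-1%g *m y).
  have z0 : z != 0 by apply: veronese_vec_neq0; exact: slval_mul_neq0.
  have : slval (repr g) *m z = 0.
    have g0 : slval (repr g) != 0.
      by apply/eqP => g0; have := slP (repr g); rewrite g0 det0 => /esym/eqP; rewrite oner_eq0.
    have [b b0] := pclassK g0; rewrite e => /(congr1 (mulmx^~ z)) /=.
    rewrite Mz veronese_mx_vec mulmxA -slM mulgV mul1mx mxE /= subn0 bin0 mul1r.
    rewrite !mxE /= expr0n eqn0Ngt n_gt0 /= mul0r mulr0 scale0r -scalemxAl => /esym/eqP.
    by rewrite scaler_eq0 (negPf b0) => /eqP.
  by move=> gz; case/eqP: z0; rewrite -(mulKmx (sl_unit (repr g)) z) gz mulmx0.
- apply/seteqP; split=> [_ [z kz <-]|_ ->] /=.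
    rewrite psi_pclass // /qp_app Mz.
    have s0 : d * (V W *m prepr z) 0 0 != 0.
      by apply/eqP => s0; apply: kz; rewrite /qp_ker /= Mz s0 scale0r.
    exact/esym/(pclass_eq s0 erefl).
  pose z := V W^-1%g *m veronese_vec n e1.
  have z0 : z != 0 by apply: veronese_mul_neq0; rewrite veronese_vec_neq0 // e1_neq0.
  have [b b0 bE] := pclassK z0.
  have s0 : (V W *m prepr (pclass z)) 0 0 != 0.
    by rewrite bE -scalemxAr mulmxA veronese_slVr mul1mx veronese_vec_e1 !mxE mulr1.
  exists (pclass z).
    move=> /eqP; rewrite Mz scaler_eq0 mulf_eq0 (negPf d0) (negPf s0) /=.
    by rewrite (negPf nx0).
  rewrite psi_pclass // /qp_app Mz.
  by apply/esym/(pclass_eq _ erefl); rewrite mulf_neq0.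
- rewrite psi_pclass // /qp_ker /= Mz.
  have [b b0 ->] := pclassK nx0; move/eqP; rewrite scaler_eq0 (negPf nx0) orbF.
  rewrite mulf_eq0 (negPf d0) /= -scalemxAr mxE mulf_eq0 (negPf b0) /=.
  rewrite veronese_mx_vec mxE /= subn0 bin0 mul1r expr0 mulr1 expf_eq0 n_gt0 /=.
  by rewrite /x mulmxA mulmx_e1 (negPf WU).
Qed.

(** Any limit matrix contributes to the extended limit set, even when its own sequence is not of
    loxodromic type: replacing M by M h keeps the image and, for suitable h, moves the kernel off
    it. *)
Lemma limit_mx_xi_plus G j (U W : SL R 2) k :
  subgroup G -> strongly_irreducible G -> k != 0 ->
  limit_mx G (k *: (slval U *m diag2 1 0 *m slval W)) ->
  F_plus j U `<=` \bigcup_(p in limit_set G) xi_plus n G j p.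
Proof.
move=> sG irr k0 GM x Ux.
have [h Gh WhU] : exists2 h, G (\pi_(PSL R 2) h) &
    row 0 (slval W) *m slval h *m (slval U *m e1) != 0.
  apply: strongly_irreducible_pairing => //; last exact: slval_mul_neq0 e1_neq0.
  apply/eqP => W0; have := slP W; rewrite det22.
  have -> : slval W 0 0 = row 0 (slval W) 0 0 by rewrite mxE.
  have -> : slval W 0 1 = row 0 (slval W) 0 1 by rewrite mxE.
  by rewrite W0 !mxE !mul0r subr0 => /esym/eqP; rewrite oner_eq0.
rewrite mulmxA in WhU.
have {WhU}WhU : (slval (W * h)%g *m slval U) 0 0 != 0.
  apply: contra_neq WhU => WhU; apply/matrixP => i i'.
  by rewrite !ord1 -!row_mul [RHS]mxE [LHS]mxE mulmx_e1; exact: WhU.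
pose M := slval U *m diag2 1 0 *m slval (W * h)%g.
have GM' : limit_mx G M.
  have := limit_mxZ (invr_neq0 k0) (limit_mx_mulr sG Gh GM).
  by rewrite -scalemxAl scalerA (mulVf k0) scale1r -mulmxA -(slM W h).
have [A [u [a [v [U' [W' [l [GA injA sv alt [l0 ME]]]]]]]]] := limit_mx_svd_seq GM'.
(* The extracted U' and W' may differ from U and W h, but the condition depends on M alone: it says
   that M M is nonzero. *)
have W'U' : (slval W' *m slval U') 0 0 != 0.
  have sq (X Y : SL R 2) : slval X *m diag2 1 0 *m slval Y *m (slval X *m diag2 1 0 *m slval Y) =
      (slval Y *m slval X) 0 0 *: (slval X *m diag2 1 0 *m slval Y).
    by rewrite scalemxAl scalemxAr -diag2_10_mul !mulmxA.
  have : M *m M != 0.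
    by rewrite /M sq scaler_eq0 negb_or WhU diag2_10_neq0.
  apply: contra_neq => W'U'; rewrite ME -scalemxAl -scalemxAr sq W'U' scale0r.
  by rewrite !scaler0.
have c0 m : slval (a m) 1 1 != 0.
  by have [_ _ _ _ /andP[/lt0r_neq0]] := svds_svd sv m.
have AM : mcvg (fun m => slval (a m) 1 1 *: slval (A m))
    (slval U' *m diag2 1 0 *m slval W').
  by have := svd_seq_scaled sv; rewrite expr0n.
exists (pclass (slval U' *m e1)); first exact: limit_set_svd AM.
exists (fun m => \pi_(PSL R 2) (A m)), (pclass (veronese_mx n (slval U' *m diag2 1 0 *m slval W'))),
  u, a, v, U'; split.
- exact: loxodromic_svd AM W'U'.
- split=> [m|m|m|m|m|].
  + by have [-> _ _ _ _] := svds_svd sv m.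
  + by have [_ -> _ _ _] := svds_svd sv m.
  + by have [_ _ -> _ _] := svds_svd sv m.
  + by have [_ _ _ -> _] := svds_svd sv m.
  + by have [_ _ _ _ /andP[-> _]] := svds_svd sv m; rewrite alt.
  + exact/sl_cvgP/(svds_u sv).
- rewrite -[x]pclass_prepr; apply/F_plusP; first exact: prepr_neq0.
  apply: (@osculating_limit _ _ _ U U' (W * h)%g W' l) => //.
  by apply/F_plusP; rewrite ?prepr_neq0 // pclass_prepr.
Qed.

Lemma xi_plus_limit_mx (G : set (PSL R 2)) j p (x : CP R n) :
  discrete_subgroup G -> xi_plus n G j p x ->
  exists U W : SL R 2, limit_mx G (slval U *m diag2 1 0 *m slval W) /\ F_plus j U x.
Proof.
move=> dG [gam [g [u [a [v [U [lox sd Ux]]]]]]].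
pose A m := (u m * a m * v m)%g.
have GA m : G (\pi_(PSL R 2) (A m)) by rewrite -(svd_eq sd); exact: (lox_in lox).
have injA : injective (fun m => \pi_(PSL R 2) (A m)).
  by move=> m m' /=; rewrite -!(svd_eq sd); exact: (lox_distinct lox).
have sv m : is_svd (A m) (u m) (a m) (v m).
  split=> //; [exact: svd_unitaryl sd m | exact: svd_unitaryr sd m | exact: Defs.svd_diag sd m |].
  by have /andP[-> /ltW ->] := svd_sigma sd m.
(* Extraction from the given decomposition keeps the limit of its left factors; discreteness sends
   the smaller singular value to 0. *)
have [f [U' [W [e [cf svf]]]]] := svd_seq_extract sv.
have e0 := discrete_svd_seq dG GA injA cf svf; rewrite e0 in svf.
have UU' : U = U'.
  apply: slval_inj; apply: mcvg_unique (svds_u svf).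
  by have /sl_cvgP/(cofinal_mcvg cf) := svd_cvg sd.
exists U, W; split=> //; rewrite UU'; exact: (limit_mx_svd svf (fun m => GA (f m))).
Qed.

End LoxodromicSequences.
Lemma exchange_weights (K : comNzRingType) (t s d s' d' x y : K) : s' * d' = 1 ->
  t * (s * s' * d * x) * y * (d' * d') = t * (s * (d * d') * y) * x.
Proof.
move=> sd; transitivity ((s' * d') * (t * (s * (d * d') * y) * x)); first by ring.
by rewrite sd mul1r.
Qed.

Lemma cancel_weights (K : comNzRingType) (s d y : K) p q : s * d = 1 ->
  s ^+ (p + q) * d ^+ q * (d ^+ p * y) = y.
Proof.
move=> sd; rewrite exprD.
transitivity ((s ^+ p * d ^+ p) * (s ^+ q * d ^+ q) * y); first by ring.
by rewrite -!exprMn sd !expr1n !mul1r.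
Qed.

(** * Dynamics on projective space *)

Section Dynamics.
Variables (R : realType) (n : nat).
Hypothesis n_gt0 : (0 < n)%N.
Local Notation C := R[i].
Local Notation V A := (veronese_mx n (slval A)).
Local Notation half := ((n + 2) %/ 2)%N.
Implicit Types (G : set (PSL R 2)) (A u a v : nat -> SL R 2) (U W : SL R 2).

(** floor((n+2)/2) is the least i with 2i > n, where the weight s^(n-2i) becomes contracting. *)
Lemma osculating_half U (X : 'cV[C]_n.+1) :
  osculating half U X <-> forall i : 'I_n.+1, (n < i.*2)%N -> (V U^-1%g *m X) i 0 = 0.
Proof. by split=> h i hi; apply: h; lia. Qed.

(** The flip reverses the order of the coordinates up to sign. With U = W^-1 this is the subspace at
    the repelling point, since W^-1 [flip] e_1 = - W^-1 e_2. *)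
Lemma osculating_half_flip U (X : 'cV[C]_n.+1) :
  osculating half (U * flip R)%g X <->
  forall i : 'I_n.+1, (i.*2 < n)%N -> (V U^-1%g *m X) i 0 = 0.
Proof.
have E i : (V (U * flip R)^-1%g *m X) i 0 =
    (-1) ^+ n * ((-1) ^+ i * (V U^-1%g *m X) (rev_ord i) 0).
  rewrite invgM veronese_slM -mulmxA.
  have -> : slval (flip R)^-1%g = -1 *: flip_mx C.
    by rewrite sl_adj; apply: mx22P;
      rewrite [RHS]mxE !adj22 !flip_mxE ?mulr0 ?oppr0 ?mulN1r // opprK.
  by rewrite veronese_mxZ -scalemxAl mxE veronese_flip.
split=> h i hi.
  have := h (rev_ord i); rewrite E rev_ordK => e.
  have /e/eqP : (half <= rev_ord i)%N by rewrite /=; have := ltn_ord i; lia.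
  by rewrite !mulf_eq0 !expf_eq0 oppr_eq0 oner_eq0 !andbF /= => /eqP.
by rewrite E h ?mulr0 //=; have := ltn_ord i; lia.
Qed.

Lemma svd_veronese A u a v U W e m (X : 'cV[C]_n.+1) i : svd_seq A u a v U W e ->
  (V (u m)^-1%g *m (V (A m) *m X)) i 0 =
  slval (a m) 0 0 ^+ (n - i) * slval (a m) 1 1 ^+ i * (V (v m) *m X) i 0.
Proof.
move=> sv; have [/= -> _ _ da _] := svds_svd sv m.
rewrite !veronese_slM !mulmxA veronese_slV mul1mx -mulmxA {1}(sl_diagE da).
rewrite mxE (bigD1 i) //= big1 ?addr0 => [|k ki]; rewrite veronese_diag2.
  by rewrite eqxx.
by rewrite eq_sym (negPf ki) mul0r.
Qed.

(** In adapted coordinates Y_l = t s^(n-l) d^l X_l with s d = 1, whence Y_k X_i = d^(2(k-i)) Y_i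
    X_k, free of the uncontrolled scalar t. For 2i < n < 2k the right side tends to 0, so X'_i != 0
    forces Y'_k = 0. *)
Lemma svd_seq_dynamics A u a v U W (X Y : nat -> 'cV[C]_n.+1) (t : nat -> C) X' Y' :
  svd_seq A u a v U W 0 -> mcvg X X' -> mcvg Y Y' ->
  (forall m, Y m = t m *: (V (A m) *m X m)) ->
  osculating half (W^-1 * flip R)%g X' \/ osculating half U Y'.
Proof.
move=> sv XX' YY' YE; have [|nX] := pselect (osculating half (W^-1 * flip R)%g X').
  by left.
right; have [i [hi Xi]] : exists i : 'I_n.+1, (i.*2 < n)%N /\ (V W *m X') i 0 != 0.
  apply: contrapT => h; apply: nX; apply/osculating_half_flip => i hi.
  rewrite invgK; apply/eqP/negPn/negP => Xi; apply: h; by exists i.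
apply/osculating_half => k hk.
have VX : mcvg (fun m => V (v m) *m X m) (V W *m X').
  exact: mcvgM (mcvg_veronese (svds_v sv)) XX'.
have VY : mcvg (fun m => V (u m)^-1%g *m Y m) (V U^-1%g *m Y').
  apply: mcvgM YY'; apply: mcvg_veronese; rewrite sl_adj.
  by apply: mcvg_ext (mcvg_adj22 (svds_u sv)) => m; rewrite sl_adj.
apply: (mulIf Xi); rewrite mul0r.
apply: ncvg_unique (ncvgM (VY k 0) (VX i 0)) _.
have ik : (i < k)%N by lia.
have := ncvgM (ncvgM (VY i 0) (VX k 0)) (ncvgX (k - i).*2 (svds_e sv)).
rewrite expr0n double_eq0 subn_eq0 leqNgt ik mulr0.
congr ncvg; apply/funext => m; have [_ _ _ da _] := svds_svd sv m.
have YmE l : (V (u m)^-1%g *m Y m) l 0 = t m * (slval (a m) 0 0 ^+ (n - l) *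
    slval (a m) 1 1 ^+ l * (V (v m) *m X m) l 0).
  by rewrite YE -scalemxAr mxE (svd_veronese _ _ _ sv).
rewrite !YmE.
have ad := sl_diag_det da; set s := slval (a m) 0 0 in ad *; set d := slval (a m) 1 1 in ad *.
have -> : s ^+ (n - i) = s ^+ (n - k) * s ^+ (k - i).
  by rewrite -exprD; congr (_ ^+ _); have := ltn_ord k; lia.
have -> : d ^+ k = d ^+ i * d ^+ (k - i) by rewrite -exprD subnKC // ltnW.
have : s ^+ (k - i) * d ^+ (k - i) = 1 by rewrite -exprMn ad expr1n.
rewrite -addnn exprD; set s' := s ^+ (k - i); set d' := d ^+ (k - i) => sd.
exact: exchange_weights.
Qed.

(** The complement of W' is open, so a small perturbation of the middle coordinate stays in it; a
    nonzero middle coordinate can be scaled to 1. For odd n there is no middle coordinate. *)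
Lemma generic_middle (W' : set (CP R n)) U (y : 'cV[C]_n.+1) : closed W' -> y != 0 ->
  ~ W' (pclass (V U *m y)) -> exists y' : 'cV[C]_n.+1,
  [/\ y' != 0, ~ W' (pclass (V U *m y')),
      forall i : 'I_n.+1, i.*2 = n -> y' i 0 = 1 &
      forall i : 'I_n.+1, i.*2 <> n -> y i 0 = 0 -> y' i 0 = 0].
Proof.
move=> cW y0 yW.
pose e : 'cV[C]_n.+1 := \col_i (i.*2 == n)%:R.
pose Y k := y + k.+1%:R^-1 *: e.
have YE k i : Y k i 0 = y i 0 + k.+1%:R^-1 * (i.*2 == n)%:R by rewrite !mxE.
have Yy : mcvg Y y.
  move=> i j; rewrite ord1 -[y i 0]addr0 -[X in _ + X](mul0r (i.*2 == n)%:R).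
  rewrite (_ : (fun k => _) = fun k => y i 0 + k.+1%:R^-1 * (i.*2 == n)%:R).
    apply: ncvgD; first exact: ncvg_cst.
    apply: ncvgM (ncvg_cst _); exact: ncvg_invSn.
  by apply/funext => k; rewrite YE.
have [N1 hN1] := mcvg_neq0 y0 Yy.
have Wy : nbhs (pclass (V U *m y)) (~` W').
  by apply: open_nbhs_nbhs; split=> //; exact: closed_openC.
have VUY : mcvg (fun k => V U *m Y k) (V U *m y) := mcvgM (mcvg_cst _) Yy.
have [N2 _ hN2] := pclass_cvg (veronese_mul_neq0 U y0) VUY Wy.
have [[i0 mid]|nomid] := pselect (exists i0 : 'I_n.+1, i0.*2 = n); last first.
  pose k := maxn N1 N2; exists (Y k); split=> [||i hi|i hi yi].
  - by apply: hN1; exact: leq_maxl.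
  - exact: (hN2 k (leq_maxr _ _)).
  - by case: nomid; exists i.
  - by rewrite YE yi add0r; case: eqP => // _; rewrite mulr0.
have [N3 hN3] : exists N3, forall k, (N3 <= k)%N -> Y k i0 0 != 0.
  have [yi0|/ncvg_neq0] := eqVneq (y i0 0) 0; last exact.
  by exists 0%N => k _; rewrite YE yi0 mid eqxx add0r mulr1 invr_eq0 pnatr_eq0.
pose k := maxn (maxn N1 N2) N3.
have c0 : Y k i0 0 != 0 by apply: hN3; exact: leq_maxr.
exists ((Y k i0 0)^-1 *: Y k); split=> [||i hi|i hi yi].
- by rewrite scaler_eq0 invr_eq0 negb_or c0 hN1 // !leq_max leqnn.
- rewrite -scalemxAr -(pclass_eq (invr_neq0 c0) erefl).
  by apply: (hN2 k); rewrite /= !leq_max leqnn orbT.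
- rewrite mxE (_ : i = i0) ?mulVf //; apply: val_inj => /=.
  by apply: double_inj; rewrite hi mid.
- by rewrite mxE (YE k i) yi add0r; case: eqP => // _; rewrite !mulr0.
Qed.

(** If the image of T is scalar, its corner entries T10^n and T01^n vanish, so T is diagonal, and
    equality of its first two diagonal entries gives T00 = T11. Injectivity turns infinitely many
    elements of Gamma into infinitely many of its image. *)
Lemma rho_inj : injective (@rho R n).
Proof.
move=> g h; rewrite -[g]reprK -[h]reprK !rho_pi => /psl_eqP[c c0].
rewrite !mkSLK => ghE; set A := repr g in ghE *; set B := repr h in ghE *.
pose T := (A^-1 * B)%g.
have TE : V T = c%:M.
  by rewrite veronese_slM ghE -scalemxAr veronese_slV scalemx1.
have TEij i j : V T i j = (c%:M : 'M[C]_n.+1) i j by rewrite TE.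
have T10 : slval T 1 0 = 0.
  have := TEij ord_max 0; rewrite [RHS]mxE mxE /= subn0 expr0 mulr1.
  rewrite coef_lin_top -val_eqE /= eqn0Ngt n_gt0 mulr0n => /eqP.
  by rewrite expf_eq0 n_gt0 => /eqP.
have T01 : slval T 0 1 = 0.
  have := TEij 0 ord_max; rewrite [RHS]mxE mxE /= subnn expr0 mul1r.
  rewrite -horner_coef0 !hornerE -val_eqE /= eq_sym eqn0Ngt n_gt0 mulr0n => /eqP.
  by rewrite expf_eq0 n_gt0 => /eqP.
have Td : slval T = diag2 (slval T 0 0) (slval T 1 1).
  by apply: mx22P; rewrite !diag2E.
have T00 : slval T 0 0 != 0.
  by apply/eqP => T00; have := slP T; rewrite Td det_diag2 T00 mul0r => /esym/eqP; rewrite oner_eq0.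
have T11 : slval T 1 1 = slval T 0 0.
  have e0 : slval T 0 0 ^+ n = c.
    have := TEij 0 0; rewrite {1}Td veronese_diag2 eqxx subn0 expr0 mulr1 => ->.
    by rewrite mxE eqxx.
  have e1 : slval T 0 0 ^+ (n - 1) * slval T 1 1 = c.
    have := TEij (inord 1) (inord 1).
    by rewrite {1}Td veronese_diag2 eqxx inordK // expr1 => ->; rewrite mxE eqxx.
  have Tn0 : slval T 0 0 ^+ (n - 1) != 0 by rewrite expf_neq0.
  by apply: (mulfI Tn0); rewrite e1 -exprSr -e0; congr (_ ^+ _); lia.
apply/psl_eqP; exists (slval T 0 0) => //.
have -> : B = (A * T)%g by rewrite /T mulgA mulgV mul1g.
have TS : slval T = slval T 0 0 *: 1%:M.
  by rewrite {1}Td T11 -diag2_1; apply: mx22P; rewrite !mxE ?mulr1 ?mulr0.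
by rewrite slM {1}TS -scalemxAr mulmx1.
Qed.

(* For x in the repelling and y in the attracting subspace (with middle coordinate
   1 in the even case) there are X m -> x with rho (A m) (X m) -> y; if neither x
   nor y were in W', proper discontinuity would fail. *)
Lemma pd_complement_dichotomy G (W' : set (CP R n)) A u a v U W :
  pd_complement (rho n @` G) W' -> svd_seq A u a v U W 0 ->
  (forall m, G (\pi_(PSL R 2) (A m))) -> injective (fun m => \pi_(PSL R 2) (A m)) ->
  (F_plus half U : set (CP R n)) `<=` W' \/
  (F_plus half (W^-1 * flip R)%g : set (CP R n)) `<=` W'.
Proof.
move=> [cW _ [_ pdW]] sv GA injA; apply: contrapT => /not_orP[].
move=> /existsNP[y /not_implyP[Uy yW]] /existsNP[x /not_implyP[Wx xW]].
rewrite -[y]pclass_prepr in Uy yW; rewrite -[x]pclass_prepr in Wx xW.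
have {}Uy := (F_plusP _ _ (prepr_neq0 y)).1 Uy.
have {}Wx := (F_plusP _ _ (prepr_neq0 x)).1 Wx.
move/osculating_half: Uy; move/osculating_half_flip: Wx; rewrite invgK => Wx Uy.
have [y' [y'0 y'W y'mid y'z]] : exists y' : 'cV[C]_n.+1,
  [/\ y' != 0, ~ W' (pclass (V U *m y')),
      forall i : 'I_n.+1, i.*2 = n -> y' i 0 = 1 &
      forall i : 'I_n.+1, i.*2 <> n -> (V U^-1%g *m prepr y) i 0 = 0 -> y' i 0 = 0].
  apply: generic_middle cW _ _; first exact: veronese_mul_neq0 (prepr_neq0 y).
  by rewrite mulmxA veronese_slVr mul1mx.
have [x' [x'0 x'W x'mid x'z]] : exists x' : 'cV[C]_n.+1,
  [/\ x' != 0, ~ W' (pclass (V W^-1%g *m x')),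
      forall i : 'I_n.+1, i.*2 = n -> x' i 0 = 1 &
      forall i : 'I_n.+1, i.*2 <> n -> (V W *m prepr x) i 0 = 0 -> x' i 0 = 0].
  apply: generic_middle cW _ _; first exact: veronese_mul_neq0 (prepr_neq0 x).
  by rewrite mulmxA veronese_slV mul1mx.
have {}y'z (i : 'I_n.+1) : (n < i.*2)%N -> y' i 0 = 0 by move=> hi; apply: y'z; [lia | exact: Uy].
have {}x'z (i : 'I_n.+1) : (i.*2 < n)%N -> x' i 0 = 0 by move=> hi; apply: x'z; [lia | exact: Wx].
pose d m := slval (a m) 1 1.
(* The diagonal part multiplies coordinate i by d^(2i-n). It therefore carries Z to Z': the low
   coordinates of Z are prepared to become those of y', the high ones of x' are contracted, and the
   middle ones agree, being both 1. *)
pose Z m : 'cV[C]_n.+1 := \col_(i < n.+1)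
  (if (i.*2 < n)%N then d m ^+ (n - i.*2) * y' i 0 else x' i 0).
pose Z' m : 'cV[C]_n.+1 := \col_(i < n.+1)
  (if (n < i.*2)%N then d m ^+ (i.*2 - n) * x' i 0 else y' i 0).
have d0 : ncvg d 0 := svds_e sv.
have Zx : mcvg Z x'.
  move=> i j; rewrite ord1; case: (ltnP i.*2 n) => hi.
    rewrite x'z // (_ : (fun k => _) = fun k => d k ^+ (n - i.*2) * y' i 0).
      rewrite -(mul0r (y' i 0)); apply: ncvgM (ncvg_cst _).
      by have := ncvgX (n - i.*2) d0; rewrite expr0n subn_eq0 leqNgt hi.
    by apply/funext => k; rewrite mxE hi.
  rewrite (_ : (fun k => _) = fun k => x' i 0); first exact: ncvg_cst.
  by apply/funext => k; rewrite mxE ltnNge hi.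
have Zy : mcvg Z' y'.
  move=> i j; rewrite ord1; case: (ltnP n i.*2) => hi.
    rewrite y'z // (_ : (fun k => _) = fun k => d k ^+ (i.*2 - n) * x' i 0).
      rewrite -(mul0r (x' i 0)); apply: ncvgM (ncvg_cst _).
      by have := ncvgX (i.*2 - n) d0; rewrite expr0n subn_eq0 leqNgt hi.
    by apply/funext => k; rewrite mxE hi.
  rewrite (_ : (fun k => _) = fun k => y' i 0); first exact: ncvg_cst.
  by apply/funext => k; rewrite mxE ltnNge hi.
pose X m := V (v m)^-1%g *m Z m; pose Y m := V (u m) *m Z' m.
have XY m : V (A m) *m X m = Y m.
  rewrite /Y -[LHS]mul1mx -(veronese_slVr n (u m)) -mulmxA; congr (_ *m _).
  apply/colP => i; rewrite (svd_veronese _ _ _ sv) mulmxA veronese_slVr mul1mx !mxE.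
  have [_ _ _ da _] := svds_svd sv m; have := sl_diag_det da; rewrite -/(d m).
  set s := slval (a m) 0 0 => sd.
  case: ltngtP => hi.
  - have -> : (n - i = (n - i.*2) + i)%N by lia.
    exact: cancel_weights.
  - have {2}-> : (i = (n - i) + (i.*2 - n) :> nat)%N by have := ltn_ord i; lia.
    by rewrite exprD !mulrA -exprMn sd expr1n mul1r.
  - have -> : (n - i = i)%N by lia.
    by rewrite -exprMn sd expr1n mul1r x'mid // y'mid.
have XX : mcvg X (V W^-1%g *m x').
  apply: mcvgM Zx; apply: mcvg_veronese; rewrite sl_adj.
  by apply: mcvg_ext (mcvg_adj22 (svds_v sv)) => m; rewrite sl_adj.
have YY : mcvg Y (V U *m y') := mcvgM (mcvg_veronese (svds_u sv)) Zy.
have Xn0 := veronese_mul_neq0 W^-1%g x'0; have Yn0 := veronese_mul_neq0 U y'0.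
have nW z : ~ W' z -> nbhs z (~` W').
  by move=> zW; apply: open_nbhs_nbhs; split=> //; exact: closed_openC.
have [N1 hN1] := mcvg_neq0 Xn0 XX.
have [N2 _ hN2] := pclass_cvg Xn0 XX (nW _ x'W).
have [N3 _ hN3] := pclass_cvg Yn0 YY (nW _ y'W).
pose N := maxn N1 (maxn N2 N3).
have N1k k : (N1 <= N + k)%N by rewrite (leq_trans _ (leq_addr _ _)) // leq_max leqnn.
have N2k k : (N2 <= N + k)%N by rewrite (leq_trans _ (leq_addr _ _)) // !leq_max leqnn orbT.
have N3k k : (N3 <= N + k)%N by rewrite (leq_trans _ (leq_addr _ _)) // !leq_max leqnn !orbT.
have cN := cofinal_addn N.
(* K1 and K2 are convergent sequences with their limits, cut off at N to avoid W'. Every A (N + k)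
   carries a point of K1 into K2, so infinitely many elements return to their union. *)
pose K1 := pclass (V W^-1%g *m x') |` range (fun k => pclass (X (N + k)%N)).
pose K2 := pclass (V U *m y') |` range (fun k => pclass (Y (N + k)%N)).
have cK : compact (K1 `|` K2).
  apply: compactU; apply: compact_cvg_seq.
    exact: (pclass_cvg Xn0 (cofinal_mcvg cN XX)).
  exact: (pclass_cvg Yn0 (cofinal_mcvg cN YY)).
have KW : K1 `|` K2 `<=` ~` W'.
  move=> z [[->//|[k _ <-]]|[->//|[k _ <-]]].
    exact: (hN2 _ (N2k k)).
  exact: (hN3 _ (N3k k)).
have := pdW _ cK KW; set S := [set g | _] => finS.
pose s k := rho n (\pi_(PSL R 2) (A (N + k)%N)).
have sS k : S (s k).
  split; first by exists (\pi_(PSL R 2) (A (N + k)%N)).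
  exists (pclass (Y (N + k)%N)); split; last by right; right; exists k.
  exists (pclass (X (N + k)%N)); first by left; right; exists k.
  by rewrite /s rho_act ?XY // hN1.
have injs : injective s by move=> k l /rho_inj /injA /addnI.
apply: infinite_nat; rewrite (_ : setT = s @^-1` S).
  by apply: finite_preimage finS => k l _ _; exact: injs.
by apply/seteqP; split=> // k _; exact: sS.
Qed.

End Dynamics.
Lemma infinite_injective_seq (T : Type) (S : set T) : ~ finite_set S ->
  exists s : nat -> T, injective s /\ forall k, S (s k).
Proof.
elim/Ppointed: T => T in S *.
  by rewrite emptyE => h; case: h; exact: finite_set0.
move/infiniteP/pcard_leP/injfunPex => [f fS injf].
exists f; split=> [k l fkl|k]; last exact: fS.
by apply: injf => //; rewrite in_setT.
Qed.

(** * The extended limit set *)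

Section ExtendedLimitSet.
Variables (R : realType) (n : nat).
Hypothesis n_gt0 : (0 < n)%N.
Local Notation C := R[i].
Local Notation V A := (veronese_mx n (slval A)).
Local Notation half := ((n + 2) %/ 2)%N.
Implicit Types (G : set (PSL R 2)) (U W : SL R 2).

Definition attracting_union G : set (CP R n) :=
  [set x | exists U W, limit_mx G (slval U *m diag2 1 0 *m slval W) /\ F_plus half U x].

Lemma L_CG_extE G : discrete_subgroup G -> strongly_irreducible G ->
  L_CG_ext n G = closure (attracting_union G).
Proof.
move=> dG irr; congr closure; apply/seteqP; split=> [x [p _]|x [U [W [GM Ux]]]].
  exact: xi_plus_limit_mx.
apply: (limit_mx_xi_plus n_gt0 dG.1 irr (oner_neq0 _) _ Ux).
by rewrite scale1r; exact: GM.
Qed.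

Lemma closure_lift m k (S : set (PM R m k)) (x : PM R m k) : closure S x ->
  exists X : nat -> 'M[C]_(m.+1, k.+1),
    [/\ mcvg X (prepr x), forall i, X i != 0 & forall i, S (pclass (X i))].
Proof.
move=> Sx.
have /choice[X hX] l : exists B : 'M[C]_(m.+1, k.+1), [/\ B != 0, S (pclass B) &
    forall i j, `|prepr x i j - B i j| < l.+1%:R^-1].
  have l0 : 0 < l.+1%:R^-1 :> C by rewrite invr_gt0 ltr0n.
  have [z [Sz [B [B0 xB] Bz]]] := Sx _ (pclass_nbhs x l0).
  by exists B; rewrite Bz.
exists X; split=> [i j|i|i]; last 2 first.
- by have [] := hX i.
- by have [] := hX i.
move=> e /ncvg_invSn[N hN]; exists N => l /hN.
rewrite sub0r normrN ger0_norm ?invr_ge0 ?ler0n //.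
by have [_ _ /(_ i j)] := hX l; exact: lt_trans.
Qed.

Lemma closure_attracting_union_invariant G : subgroup G ->
  invariant_set (rho n @` G) (closure (attracting_union G)).
Proof.
move=> sG _ z [g Gg <-] /closure_lift[X [Xz X0 SX]].
rewrite -[g]reprK in Gg *; set A := repr g in Gg *.
rewrite -[z]pclass_prepr rho_act ?prepr_neq0 //.
apply: (closure_seq (X := fun k => V A *m X k)).
- exact: veronese_mul_neq0 (prepr_neq0 z).
- exact: mcvgM (mcvg_cst _) Xz.
move=> k; have [U [W [GM Uk]]] := SX k; exists (A * U)%g, W; split.
  by have := limit_mx_mull sG Gg GM; rewrite !mulmxA.
apply/F_plusP; first exact: veronese_mul_neq0.
by apply: osculating_mull; apply/F_plusP.
Qed.

Lemma rho_actK (g : PSL R 2) (z : CP R n) : psl_act (rho n g^-1%g) (psl_act (rho n g) z) = z.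
Proof.
rewrite -[g]reprK psl_piVE; set A := repr g.
have z0 := prepr_neq0 z; have Az0 := veronese_mul_neq0 A z0.
rewrite -[in LHS](pclass_prepr z) (rho_act A z0) (rho_act _ Az0) mulmxA veronese_slV mul1mx.
exact: pclass_prepr.
Qed.

Lemma invariant_setC G (S : set (CP R n)) : subgroup G ->
  invariant_set (rho n @` G) S -> invariant_set (rho n @` G) (~` S).
Proof.
move=> sG invS _ z [g Gg <-] Sz Sgz; apply: Sz.
have Gg' : G g^-1%g by exact: subgroupV.
by have := invS (rho n g^-1%g) _ (ex_intro2 _ _ _ Gg' erefl) Sgz; rewrite rho_actK.
Qed.

Lemma diag2_01_flip : diag2 0 1 = slval (flip R) *m diag2 1 0 *m slval (flip R)^-1%g :> 'M[C]_2.
Proof.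
rewrite sl_adj mkSLK; apply: mx22P.
all: by rewrite !mulmx2E !adj22 !flip_mxE !diag2E; ring.
Qed.

(** The inverse sequence has attracting and repelling point interchanged: the image is now spanned
    by W^-1 e_2 and the kernel by U e_1. *)
Lemma adj_svd_limit U W : \adj (slval U *m diag2 1 0 *m slval W) =
  slval (W^-1 * flip R)%g *m diag2 1 0 *m slval ((flip R)^-1 * U^-1)%g.
Proof.
rewrite !adj22M -!sl_adj.
have -> : \adj (diag2 1 0) = diag2 0 1 :> 'M[C]_2.
  by apply: mx22P; rewrite !adj22 !diag2E ?oppr0.
by rewrite diag2_01_flip !slM !mulmxA.
Qed.

(** Infinitely many returns to K provide points of K with images in K, both convergent after
    extraction. One of the two limits lies in a fibre of the union, which K avoids. *)
Lemma attracting_union_properly_discontinuous G : discrete_subgroup G ->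
  acts_properly_discontinuously (rho n @` G) (~` closure (attracting_union G)).
Proof.
move=> dG; have [sG _] := dG; split.
  exact/invariant_setC/closure_attracting_union_invariant.
move=> K cK KS; apply: contrapT => /infinite_injective_seq[g [injg gK]].
have /choice[A hA] m : exists A : SL R 2,
    G (\pi_(PSL R 2) A) /\ g m = rho n (\pi_(PSL R 2) A).
  by have [[h Gh <-] _] := gK m; exists (repr h); rewrite reprK.
have GA m : G (\pi_(PSL R 2) (A m)) := (hA m).1.
have injA : injective (fun m => \pi_(PSL R 2) (A m)).
  by move=> k l e; apply: injg; rewrite (hA k).2 (hA l).2 e.
have /choice[z hz] m : exists z, K z /\ K (psl_act (g m) z).
  by have [_ [_ [[z Kz <-] Kgz]]] := gK m; exists z.
have [f1 [u [a [v [U [W [e [cf1 sv]]]]]]]] := svd_extract A.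
have e0 := discrete_svd_seq dG GA injA cf1 sv; subst e.
have [f2 [X [X' [cf2 XX' [X'0 KX'] X0 Xz]]]] :=
  compact_lift cK (fun m => (hz (f1 m)).1).
have [f3 [Y [Y' [cf3 YY' [Y'0 KY'] Y0 Yz]]]] :=
  compact_lift cK (fun m => (hz (f1 (f2 m))).2).
(* The representatives of a point and of its image were scaled independently; t records the
   discrepancy. *)
have /choice[t ht] m : exists t : C, Y m = t *: (V (A (f1 (f2 (f3 m)))) *m X (f3 m)).
  have := Yz m; rewrite -Xz (hA _).2 rho_act // => e.
  have [c c0 cE] := pclassK (Y0 m).
  have [d d0 dE] := pclassK (veronese_mul_neq0 (A (f1 (f2 (f3 m)))) (X0 (f3 m))).
  exists (c^-1 * d); rewrite -scalerA -dE -e cE scalerA mulVf ?scale1r //.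
have GM : limit_mx G (slval U *m diag2 1 0 *m slval W).
  exact: limit_mx_svd sv (fun m => GA (f1 m)).
have sv' := svd_seq_cofinal (cofinal_comp cf2 cf3) sv.
have [XS|YS] := svd_seq_dynamics n_gt0 sv' (cofinal_mcvg cf3 XX') YY' ht.
  apply: (KS _ KX'); apply: subset_closure.
  exists (W^-1 * flip R)%g, ((flip R)^-1 * U^-1)%g; split; last exact/F_plusP.
  by rewrite -adj_svd_limit; exact: limit_mx_adj.
by apply: (KS _ KY'); apply: subset_closure; exists U, W; split=> //; exact/F_plusP.
Qed.

(* A limit matrix M = p r^T has attracting point p, and adj M has repelling point
   p.  By irreducibility some h in G makes M h (adj M) nonzero; it is a limit matrix
   with attracting and repelling point p, so the dichotomy leaves no choice. *)
Lemma attracting_union_sub_pd_complement G (W' : set (CP R n)) : subgroup G ->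
  strongly_irreducible G -> pd_complement (rho n @` G) W' ->
  attracting_union G `<=` W'.
Proof.
move=> sG irr pdW' x [U [W [GM Ux]]].
pose e1 : 'cV[C]_2 := delta_mx 0 0.
have [h Gh hW] : exists2 h, G (\pi_(PSL R 2) h) &
    row 0 (slval W) *m slval h *m (slval (W^-1 * flip R)%g *m e1) != 0.
  apply: strongly_irreducible_pairing => //.
    apply/eqP => W0; have := slP W; rewrite det22.
    have -> : slval W 0 0 = row 0 (slval W) 0 0 by rewrite mxE.
    have -> : slval W 0 1 = row 0 (slval W) 0 1 by rewrite mxE.
    by rewrite W0 !mxE !mul0r subr0 => /esym/eqP; rewrite oner_eq0.
  exact: slval_mul_neq0 (e1_neq0 R).
(* The scalar r^T h q that M h (adj M) acquires, where r is the first row of W and q is the image of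
   adj M. *)
pose k := (slval W *m slval h *m slval (W^-1 * flip R)%g) 0 0.
have k0 : k != 0.
  apply: contra_neq hW => k0; rewrite mulmxA; apply/matrixP => i i'.
  by rewrite !ord1 -!row_mul [RHS]mxE [LHS]mxE mulmx_e1; exact: k0.
pose N := slval U *m diag2 1 0 *m slval ((flip R)^-1 * U^-1)%g.
have NE : slval U *m diag2 1 0 *m slval W *m slval h *m
    \adj (slval U *m diag2 1 0 *m slval W) = k *: N.
  rewrite adj_svd_limit /N scalemxAl scalemxAr -diag2_10_mul !mulmxA //.
have GN : limit_mx G N.
  have kN : limit_mx G (k *: N).
    have := limit_mx_mul sG (limit_mx_mulr sG Gh GM) (limit_mx_adj sG GM).
    rewrite NE; apply; rewrite scaler_eq0 negb_or k0; exact: diag2_10_neq0.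
  by have := limit_mxZ (invr_neq0 k0) kN; rewrite scalerA (mulVf k0) scale1r.
have [A [u [a [v [U' [Z [l [GA injA sv _ [l0 NE']]]]]]]]] := limit_mx_svd_seq GN.
rewrite -[x]pclass_prepr in Ux *.
have x0 := prepr_neq0 x; have {}Ux := (F_plusP _ _ x0).1 Ux.
have [FW|FW] := pd_complement_dichotomy n_gt0 pdW' sv GA injA; apply: FW; apply/(F_plusP _ _ x0).
  exact: osculating_limit NE' Ux.
(* N is nilpotent, and adj X = tr X - X for 2 x 2 matrices; hence the repelling alternative also
   yields the subspace at p. *)
have adjN : \adj N = -1 *: N.
  rewrite adj_svd_limit invgM !invgK.
  have ff : slval (flip R) *m slval (flip R) = -1 *: 1%:M.
    by rewrite !mkSLK -diag2_1; apply: mx22P; rewrite mulmx2E [RHS]mxE !flip_mxE !diag2E; ring.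
  rewrite (slM _ (flip R)) (slM U) -(mulmxA (slval U)) ff -scalemxAr mulmx1 -!scalemxAl.
  by [].
have adjN' : \adj N = l *: (slval (Z^-1 * flip R)%g *m diag2 1 0 *m
    slval ((flip R)^-1 * U'^-1)%g).
  by rewrite NE' adj22Z; congr (_ *: _); exact: adj_svd_limit.
have NN : N = (- l) *: (slval (Z^-1 * flip R)%g *m diag2 1 0 *m
    slval ((flip R)^-1 * U'^-1)%g).
  by rewrite scaleNr -adjN' adjN scaleN1r opprK.
exact: osculating_limit NN Ux.
Qed.

End ExtendedLimitSet.

Theorem theorem0p2 (R : realType) (n : nat) (hn : (1 <= n)%N)
    (Gamma : set (PSL R 2)) (hGamma : discrete_subgroup Gamma)
    (hCG : CG_property Gamma) :
  acts_properly_discontinuously (rho n @` Gamma) (~` L_CG_ext n Gamma) /\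
  minimal_pd_complement (rho n @` Gamma) (L_CG_ext n Gamma).
Proof.
have [sG _] := hGamma; have [_ irr] := hCG.
rewrite L_CG_extE //.
have pd := attracting_union_properly_discontinuous hn hGamma.
split=> //; split.
  by split=> //; [exact: closed_closure | exact: closure_attracting_union_invariant].
move=> W' pdW' W'S; apply/seteqP; split=> //.
have [cW' _ _] := pdW'; rewrite [X in _ `<=` X]((closure_id W').1 cW').
by apply: closureS; exact: (attracting_union_sub_pd_complement hn sG irr pdW').
Qed.
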